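(* Let $\alpha\in\mathbb R$. There is an infinite sequence of real numbers $\lambda$ for which Mathieu's equation $y''+(\lambda+\alpha\cos2x)y=0$ has a non-trivial real $2\pi$-periodic solution. Let $A$ be such a non-trivial real $2\pi$-periodic solution (for one such $\lambda$), and let $$W(x,y)=\frac{A(x)A'(y)-A'(x)A(y)}{\sin(x-y)},$$ which extends to a continuously differentiable function on $\mathbb R^2$, $2\pi$-periodic in each variable. Then: (i) $W$ defines a self-adjoint Hilbert–Schmidt integral operator on $L^2[0,2\pi]$; (ii) if $\nu\neq0$ is a simple eigenvalue of this operator, then any corresponding eigenfunction $f$ (extended $2\pi$-periodically) is twice continuously differentiable and is a $2\pi$-periodic solution of $f''+(\mu+\alpha\cos2x)f=0$ for some constant $\mu$. *)

(* Defs.v *)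
From HB Require Import structures.
From mathcomp Require Import all_boot all_order all_algebra.
From mathcomp Require Import all_classical all_reals all_analysis.
Set Implicit Arguments. Unset Strict Implicit. Unset Printing Implicit Defensive.
Import Order.TTheory GRing.Theory Num.Theory.
Import numFieldNormedType.Exports.
Local Open Scope classical_set_scope.
Local Open Scope ring_scope.

Section Defs.
Variable R : realType.
Local Notation mu := (@lebesgue_measure R).

Definition I02 : set R := `[0, 2 * pi]%classic.

Definition periodic2pi (f : R -> R) : Prop := forall x, f (x + 2 * pi) = f x.

Definition mathieu_sol (alpha lam : R) (y : R -> R) : Prop :=
  (forall x, derivable y x 1) /\ (forall x, derivable (derive1 y) x 1) /\
  (forall x, derive1 (derive1 y) x + (lam + alpha * cos (2 * x)) * y x = 0).

Definition C2 (f : R -> R) : Prop :=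
  (forall x, derivable f x 1) /\ (forall x, derivable (derive1 f) x 1) /\
  continuous (derive1 (derive1 f)).

Definition C1_2 (W : R -> R -> R) : Prop :=
  (forall x y, derivable (fun t => W t y) x 1 /\ derivable (fun t => W x t) y 1) /\
  continuous (fun z : R * R => W z.1 z.2) /\
  continuous (fun z : R * R => derive1 (fun t => W t z.2) z.1) /\
  continuous (fun z : R * R => derive1 (fun t => W z.1 t) z.2).

Definition sq_int (f : R -> R) : Prop :=
  measurable_fun I02 f /\ mu.-integrable I02 (fun x => ((f x) ^+ 2)%:E).

Definition intop (W : R -> R -> R) (f : R -> R) (x : R) : R :=
  Rintegral mu I02 (fun y => W x y * f y).

Definition hilbert_schmidt_kernel (W : R -> R -> R) : Prop :=
  measurable_fun (I02 `*` I02) (fun z : R * R => W z.1 z.2) /\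
  (mu \x mu)%E.-integrable (I02 `*` I02) (fun z : R * R => ((W z.1 z.2) ^+ 2)%:E) /\
  (forall f, sq_int f -> sq_int (intop W f)).

Definition self_adjoint_kernel (W : R -> R -> R) : Prop :=
  forall f g, sq_int f -> sq_int g ->
    (\int[mu]_(x in I02) ((intop W f x) * g x)%:E =
     \int[mu]_(x in I02) (f x * intop W g x)%:E)%E.

Definition eigenfun (W : R -> R -> R) (nu : R) (f : R -> R) : Prop :=
  sq_int f /\ ~ {ae mu, forall x, I02 x -> f x = 0} /\
  {ae mu, forall x, I02 x -> intop W f x = nu * f x}.

Definition simple_eigenvalue (W : R -> R -> R) (nu : R) : Prop :=
  (exists f, eigenfun W nu f) /\
  (forall f g, eigenfun W nu f -> eigenfun W nu g ->
     exists c : R, {ae mu, forall x, I02 x -> g x = c * f x}).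

End Defs.

(* Main.v *)
Require Import Defs.
From HB Require Import structures.
From mathcomp Require Import all_boot all_order all_algebra.
From mathcomp Require Import all_classical all_reals all_analysis.
From mathcomp Require Import measurable_realfun ring lra.
Import Order.TTheory GRing.Theory Num.Theory.
Import numFieldNormedType.Exports.
Local Open Scope classical_set_scope.
Local Open Scope ring_scope.
Set Implicit Arguments.
Unset Strict Implicit.

(** Infinitely many eigenvalues come from shooting: the solution with
    [y 0 = 0], [y' 0 = 1] is odd, and it is [2 pi]-periodic as soon as
    [y pi = 0], since the potential is even about both [0] and [pi].  For
    [lam = (n + 1/2)^2] a Gronwall estimate shows that [y pi] has the sign
    [(-1)^n] when [n] is large, so the intermediate value theorem gives a zero
    between consecutive such values.

    When [sin t = 0], the shift [A (x + t)] solves the same equation as [A], and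
    their Wronskian changes sign under a further shift by [t]; hence it vanishes,
    [A (x + t) = e * A x], and the numerator of [W] is zero wherever [sin (x - y)]
    is.  The same shift relation moves every singular point of [W] to the diagonal,
    where [W] is a quotient of divided differences, hence [C^1].

    The operator [T] with kernel [W] commutes with
    [L = d^2/dx^2 + alpha cos 2x].  The identity behind it is
    [W_x + W_y = K], [K = - 2 alpha sin (x + y) A(x) A(y)], together with
    [K_x - K_y = alpha (cos 2y - cos 2x) W].  Integrating by parts, the first one
    gives [(T h)' = K h + T h'] for periodic [h]; it bootstraps an eigenfunction
    [g] to [C^2], and with the second one it yields [T (L g) = L (T g) = nu (L g)].
    Simplicity of [nu] makes [L g] a multiple of [g]. *)

(** * Derivatives *)

Section PointwiseDerivatives.
Variable R : realType.
Implicit Types (f g : R -> R) (x a b : R).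

Lemma is_derive_add f g x (df dg : R) : is_derive x 1 f df -> is_derive x 1 g dg ->
  is_derive x 1 (fun t => f t + g t) (df + dg).
Proof. by move=> ? ?; exact: is_deriveD. Qed.

Lemma is_derive_opp f x (df : R) : is_derive x 1 f df ->
  is_derive x 1 (fun t => - f t) (- df).
Proof. by move=> ?; exact: is_deriveN. Qed.

Lemma is_derive_mul f g x (df dg : R) : is_derive x 1 f df -> is_derive x 1 g dg ->
  is_derive x 1 (fun t => f t * g t) (df * g x + f x * dg).
Proof.
move=> f_df g_dg; have fg := is_deriveM f_df g_dg.
by apply: (is_derive_eq fg); rewrite /GRing.scale /= addrC mulrC.
Qed.

Lemma is_derive_inv f x (df : R) : f x != 0 -> is_derive x 1 f df ->
  is_derive x 1 (fun t => (f t)^-1) (- (df / f x ^+ 2)).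
Proof.
move=> fx0 f_df; apply: (is_derive_eq (is_deriveV fx0 f_df)).
by rewrite /GRing.scale /= mulNr mulrC.
Qed.

Lemma is_derive_comp f g x (df dg : R) :
  is_derive (g x) 1 f df -> is_derive x 1 g dg ->
  is_derive x 1 (fun t => f (g t)) (df * dg).
Proof. by move=> ? ?; exact: is_derive1_comp. Qed.

Lemma is_derive_continuous f x (df : R) :
  is_derive x 1 f df -> {for x, continuous f}.
Proof. by move=> [d _]; apply: differentiable_continuous; apply/derivable1_diffP. Qed.

Lemma derive1_val f x (df : R) : is_derive x 1 f df -> derive1 f x = df.
Proof. by move=> d; rewrite derive1E derive_val. Qed.

Lemma derivable1P f x : derivable f x 1 -> is_derive x 1 f (derive1 f x).
Proof. by move=> d; rewrite derive1E; exact: derivableP. Qed.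

Lemma eq_is_derive f g x (df : R) : f =1 g -> is_derive x 1 f df -> is_derive x 1 g df.
Proof. by move=> /funext ->. Qed.

Lemma is_derive_ge0_le f (df : R -> R) a b : a <= b ->
  (forall x, is_derive x 1 f (df x)) ->
  (forall x, a <= x <= b -> 0 <= df x) -> f a <= f b.
Proof.
move=> ab f_df df0; have [|c cab fE] := @MVT_segment R f df a b ab (fun x _ => f_df x).
  by apply: derivable_within_continuous => x _; exact: ex_derive.
by rewrite -subr_ge0 fE mulr_ge0 ?subr_ge0// df0.
Qed.

End PointwiseDerivatives.

Ltac known_derive :=
  first [exact: is_derive_sin|exact: is_derive_cos|exact: is_derive_expR|solve [eauto 2]].

(* Plain [apply:] would let instance resolution pick the library's own rules,
   whose values mention scalar multiplication and are out of reach of [ring]. *)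
Ltac derive_step :=
  lazymatch goal with |- @is_derive ?R ?V ?W ?x ?v ?f ?d =>
    let f' := eval cbv beta in (fun t => f t) in change (@is_derive R V W x v f' d)
  end;
  first [ exact: is_derive_cst | exact: is_derive_id |
  lazymatch goal with
  | |- is_derive _ _ (fun t => (@?f t)^-1) _ =>
      notypeclasses refine (is_derive_inv _ _)
  | |- is_derive _ _ (fun t => @?f t + @?g t) _ =>
      notypeclasses refine (is_derive_add _ _)
  | |- is_derive _ _ (fun t => @?f t * @?g t) _ =>
      notypeclasses refine (is_derive_mul _ _)
  | |- is_derive _ _ (fun t => - @?f t) _ => notypeclasses refine (is_derive_opp _)
  | H : is_derive ?x 1 ?f _ |- is_derive ?x 1 ?f _ => exact: H
  | |- is_derive _ _ (fun t => ?f t) _ => known_derive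
  | |- is_derive _ _ (fun t => ?f (@?g t)) _ =>
      notypeclasses refine (@is_derive_comp _ f g _ _ _ _ _);
      [known_derive|]
  end ].

Ltac derive := notypeclasses refine (is_derive_eq _ _);
  [repeat derive_step|cbv beta].

Section ShiftedDerivative.
Variable R : realType.
Implicit Types (f df : R -> R).

Lemma is_derive_shift_scale f df (t e : R) : (forall x : R, is_derive x 1 f (df x)) ->
  (forall x, f (x + t) = e * f x) -> forall x, df (x + t) = e * df x.
Proof.
move=> f_df fE x.
have shifted : is_derive x 1 (fun u => f (u + t)) (df (x + t)) by derive; ring.
have scaled : is_derive x 1 (fun u => e * f u) (e * df x) by derive; ring.
by rewrite -(derive1_val (eq_is_derive fE shifted)) (derive1_val scaled).
Qed.

Lemma periodic_derive f df (t : R) : (forall x : R, is_derive x 1 f (df x)) ->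
  periodic f t -> periodic df t.
Proof.
move=> f_df ft x; rewrite (is_derive_shift_scale (e := 1) f_df) ?mul1r// => u.
by rewrite mul1r ft.
Qed.

End ShiftedDerivative.

(** * Linear second-order equations *)

Section Gronwall.
Variable R : realType.
Implicit Types (a b x : R).

Lemma gronwall (E dE : R -> R) (C D a b : R) : 0 < C -> a <= b ->
  (forall x, is_derive x 1 E (dE x)) ->
  (forall x, a <= x <= b -> dE x <= C * E x + D) ->
  E b + D / C <= (E a + D / C) * expR (C * (b - a)).
Proof.
move=> C0 ab E_dE dE_le.
pose F x := - (E x + D / C) * expR (- C * x).
have : F a <= F b.
  apply: (@is_derive_ge0_le _ F (fun x => (C * E x + D - dE x) * expR (- C * x))) => //.
  - by move=> x; rewrite /F; derive; field; rewrite gt_eqF.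
  - by move=> x xab; rewrite mulr_ge0 ?expR_ge0// subr_ge0 dE_le.
rewrite /F !mulNr lerN2 => F_le.
have -> : C * (b - a) = - (C * a) - - (C * b) by ring.
by rewrite expRB mulrA ler_pdivlMr ?expR_gt0.
Qed.

Lemma norm_mul2_le (p Q u v : R) : `|p| <= Q ->
  `|2 * p * u * v| <= Q * (u ^+ 2 + v ^+ 2).
Proof.
rewrite !ler_norml => /andP[p_ge p_le].
have : 0 <= (Q - p) * (u - v) ^+ 2 by rewrite mulr_ge0 ?sqr_ge0//; lra.
have : 0 <= (Q + p) * (u + v) ^+ 2 by rewrite mulr_ge0 ?sqr_ge0//; lra.
have : 0 <= (Q - p) * (u + v) ^+ 2 by rewrite mulr_ge0 ?sqr_ge0//; lra.
have : 0 <= (Q + p) * (u - v) ^+ 2 by rewrite mulr_ge0 ?sqr_ge0//; lra.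
by move=> *; apply/andP; split; lra.
Qed.

End Gronwall.

Section HillUniqueness.
Variable R : realType.
Implicit Types (q y dy z dz : R -> R).

Definition hill_sol q y dy :=
  (forall x : R, is_derive x 1 y (dy x)) /\
  (forall x : R, is_derive x 1 dy (- (q x * y x))).

Lemma hill_sol_reflect q y dy : hill_sol q y dy ->
  hill_sol (fun x => q (- x)) (fun x => y (- x)) (fun x => - dy (- x)).
Proof. by move=> [y_dy dy_ddy]; split => x; derive; ring. Qed.

Lemma hill_sol_shift q y dy (c : R) : hill_sol q y dy ->
  hill_sol (fun x => q (x + c)) (fun x => y (x + c)) (fun x => dy (x + c)).
Proof. by move=> [y_dy dy_ddy]; split => x; derive; ring. Qed.

Lemma hill_sol_scale q y dy (c : R) : hill_sol q y dy ->
  hill_sol q (fun x => c * y x) (fun x => c * dy x).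
Proof. by move=> [y_dy dy_ddy]; split => x; derive; ring. Qed.

Lemma hill_solB q y dy z dz : hill_sol q y dy -> hill_sol q z dz ->
  hill_sol q (fun x => y x - z x) (fun x => dy x - dz x).
Proof. by move=> [y_dy dy_ddy] [z_dz dz_ddz]; split => x; derive; ring. Qed.

Lemma eq_hill_sol p q y dy : p =1 q -> hill_sol p y dy -> hill_sol q y dy.
Proof. by move=> /funext ->. Qed.

Lemma forced_hill_energy (q z dz r : R -> R) (Q S a b : R) :
  (forall x, `|q x| <= Q) ->
  (forall x : R, is_derive x 1 z (dz x)) ->
  (forall x : R, is_derive x 1 dz (r x - q x * z x)) ->
  a <= b -> (forall x, a <= x <= b -> r x ^+ 2 <= S) ->
  z b ^+ 2 + dz b ^+ 2 + S / (2 + Q) <=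
  (z a ^+ 2 + dz a ^+ 2 + S / (2 + Q)) * expR ((2 + Q) * (b - a)).
Proof.
move=> qQ z_dz dz_ddz ab rS; have Q0 : 0 <= Q by exact: le_trans (qQ 0).
pose E x := z x ^+ 2 + dz x ^+ 2.
pose dE x := 2 * z x * dz x + 2 * dz x * (r x - q x * z x).
apply: (@gronwall _ E dE) => //; first lra.
  by move=> x; rewrite /E /dE; under eq_fun do rewrite !expr2; derive; ring.
move=> x xab; rewrite /E /dE; have := rS x xab.
have := norm_mul2_le (z x) (dz x) (qQ x); rewrite ler_norml => /andP[+ _].
move: (z x) (dz x) (r x) (q x) => u v w p puv rS_x.
have uv : 2 * u * v <= u ^+ 2 + v ^+ 2 by have := sqr_ge0 (u - v); lra.
have vw : 2 * v * w <= v ^+ 2 + w ^+ 2 by have := sqr_ge0 (v - w); lra.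
by have := sqr_ge0 u; lra.
Qed.

Lemma hill_sol_energy q y dy (Q a b : R) : (forall x, `|q x| <= Q) ->
  hill_sol q y dy -> a <= b ->
  y b ^+ 2 + dy b ^+ 2 <= (y a ^+ 2 + dy a ^+ 2) * expR ((2 + Q) * (b - a)).
Proof.
move=> qQ [y_dy dy_ddy] ab.
have := @forced_hill_energy q y dy (fun=> 0) Q 0 a b qQ y_dy.
rewrite mul0r !addr0; apply => // [x|x _]; last by rewrite expr0n.
by rewrite sub0r.
Qed.

Lemma hill_sol_unique0 q y dy (Q a : R) : (forall x, `|q x| <= Q) ->
  hill_sol q y dy -> y a = 0 -> dy a = 0 -> forall x, y x = 0.
Proof.
suff forward p z dz c : (forall x, `|p x| <= Q) -> hill_sol p z dz ->
    z c = 0 -> dz c = 0 -> forall x, c <= x -> z x = 0.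
  move=> qQ sol_y ya dya x.
  have [/(forward _ _ _ _ qQ sol_y ya dya) //|xa] := leP a x.
  rewrite -[x]opprK; apply: (forward _ _ _ (- a) _ (hill_sol_reflect sol_y)) => //=;
    by rewrite ?opprK ?dya ?oppr0// lerN2 ltW.
move=> pQ sol_z zc dzc x cx; have := hill_sol_energy pQ sol_z cx.
rewrite zc dzc expr0n addr0 mul0r => energy_le0; apply/eqP; rewrite -sqrf_eq0.
by rewrite eq_le sqr_ge0 andbT (le_trans _ energy_le0)// lerDl sqr_ge0.
Qed.

Lemma hill_sol_unique q y dy z dz (Q a : R) : (forall x, `|q x| <= Q) ->
  hill_sol q y dy -> hill_sol q z dz -> y a = z a -> dy a = dz a ->
  forall x, y x = z x.
Proof.
move=> qQ sol_y sol_z yz dyz x; apply/subr0_eq.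
by apply: (hill_sol_unique0 (a := a) qQ (hill_solB sol_y sol_z)) => /=;
  rewrite ?yz ?dyz subrr.
Qed.

Lemma hill_sol_stability p q y dy z dz (Q d a b : R) :
  (forall x, `|p x| <= Q) -> (forall x, `|q x| <= Q) ->
  (forall x, `|p x - q x| <= d) ->
  hill_sol p y dy -> hill_sol q z dz -> y a = z a -> dy a = dz a -> a <= b ->
  (z b - y b) ^+ 2 <=
  (y a ^+ 2 + dy a ^+ 2) * (d * expR ((2 + Q) * (b - a))) ^+ 2.
Proof.
move=> pQ qQ pq sol_y sol_z yz dyz ab.
have Q2 : 1 <= 2 + Q by have := le_trans (normr_ge0 _) (pQ 0); lra.
set N := y a ^+ 2 + dy a ^+ 2; set B := expR _.
have N0 : 0 <= N by rewrite addr_ge0 ?sqr_ge0.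
have B0 : 0 <= B by exact: expR_ge0.
have [[y_dy dy_ddy] [z_dz dz_ddz]] := (sol_y, sol_z).
pose u x := z x - y x; pose du x := dz x - dy x.
have u_du (x : R) : is_derive x 1 u (du x) by rewrite /u /du; derive.
have du_ddu (x : R) : is_derive x 1 du ((p x - q x) * y x - q x * u x).
  by rewrite /u /du; derive; ring.
have forcing x : a <= x <= b -> ((p x - q x) * y x) ^+ 2 <= d ^+ 2 * (N * B).
  move=> /andP[ax xb]; rewrite exprMn ler_pM ?sqr_ge0//.
    by rewrite -real_normK ?num_real// lerXn2r ?nnegrE// (le_trans _ (pq x)).
  apply: le_trans (_ : y x ^+ 2 + dy x ^+ 2 <= _); first by rewrite lerDl sqr_ge0.
  rewrite (le_trans (hill_sol_energy pQ sol_y ax))// ler_wpM2l// ler_expR.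
  by rewrite ler_wpM2l ?lerB// (le_trans ler01).
have := forced_hill_energy qQ u_du du_ddu ab forcing.
rewrite {2}/u {2}/du yz dyz !subrr !expr0n !add0r -/B => energy.
have S0 : 0 <= d ^+ 2 * (N * B) by rewrite mulr_ge0 ?sqr_ge0 ?mulr_ge0.
have S_le : d ^+ 2 * (N * B) / (2 + Q) * B <= N * (d * B) ^+ 2.
  rewrite [leRHS](_ : _ = d ^+ 2 * (N * B) * B); last by ring.
  by rewrite ler_wpM2r// ler_pdivrMr ?ler_peMr// (lt_le_trans ltr01).
apply: le_trans S_le; apply: le_trans energy; rewrite -addrA lerDl.
by rewrite addr_ge0 ?sqr_ge0// divr_ge0// (le_trans ler01).
Qed.

Lemma hill_sol_wronskian q y dy z dz (a b : R) :
  hill_sol q y dy -> hill_sol q z dz ->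
  y a * dz a - dy a * z a = y b * dz b - dy b * z b.
Proof.
move=> [y_dy dy_ddy] [z_dz dz_ddz].
apply: (@is_derive_0_is_cst _ (fun x => y x * dz x - dy x * z x)) => x.
by derive; ring.
Qed.

Lemma hill_sol_half_period q y dy (Q p : R) : (forall x, `|q x| <= Q) ->
  hill_sol q y dy -> periodic q p -> periodic y (p + p) -> (exists x, y x != 0) ->
  exists e, forall x, y (x + p) = e * y x.
Proof.
move=> qQ sol_y qp yp [a ya].
have sol_yp := eq_hill_sol qp (hill_sol_shift p sol_y).
have dyp := periodic_derive sol_y.1 yp.
(* The Wronskian of y and its shift is constant, yet changes sign under x -> x + p *)
have wronskian0 : y a * dy (a + p) = dy a * y (a + p).
  have := hill_sol_wronskian a (a + p) sol_y sol_yp.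
  by rewrite /= -!addrA yp dyp; lra.
exists (y (a + p) / y a).
apply: (hill_sol_unique (a := a) qQ sol_yp (hill_sol_scale _ sol_y)).
  by rewrite /= divfK.
by apply: (mulIf ya); rewrite mulrAC divfK// mulrC wronskian0 mulrC.
Qed.

Lemma hill_dirichlet_periodic q y dy (Q p : R) : (forall x, `|q x| <= Q) ->
  (forall x, q (- x) = q x) -> periodic q p -> hill_sol q y dy ->
  y 0 = 0 -> y p = 0 -> periodic y (p + p).
Proof.
move=> qQ q_even qp sol_y y0 yp.
have antisymmetric z dz : hill_sol q z dz -> z 0 = 0 -> forall x, z x = - z (- x).
  move=> sol_z z0 x; rewrite -mulN1r.
  apply: (hill_sol_unique (a := 0) qQ sol_z
    (eq_hill_sol q_even (hill_sol_scale (-1) (hill_sol_reflect sol_z)))).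
    by rewrite /= oppr0 z0 mulr0.
  by rewrite /= oppr0 mulrN mulN1r opprK.
have odd_about_p x : y (x + p) = - y (- x + p).
  apply: (antisymmetric _ _ (eq_hill_sol qp (hill_sol_shift p sol_y))).
  by rewrite add0r.
move=> x; rewrite addrA odd_about_p opprD subrK.
by rewrite -(antisymmetric _ _ sol_y y0).
Qed.

End HillUniqueness.

Section Primitive.
Variable R : realType.
Notation mu := (@lebesgue_measure R).
Implicit Types (f : R -> R) (a b c x : R).

Lemma continuous_itv_integrable f a b : continuous f ->
  mu.-integrable `[a, b] (EFin \o f).
Proof.
move=> cf; apply: continuous_compact_integrable; first exact: segment_compact.
exact: continuous_subspaceT.
Qed.

Lemma Rintegral_itv_ge f a b : b <= a -> Rintegral mu `[a, b] f = 0.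
Proof.
rewrite le_eqVlt => /predU1P[->|ba]; first by rewrite set_itv1 Rintegral_set1.
by rewrite set_itv_ge ?Rintegral_set0// bnd_simp -ltNge.
Qed.

Lemma Rintegral_itvD f a b c : mu.-integrable `[a, c] (EFin \o f) -> a <= b -> b <= c ->
  Rintegral mu `[a, c] f = Rintegral mu `[a, b] f + Rintegral mu `[b, c] f.
Proof.
move=> fi ab bc; apply/eqP; rewrite addrC -subr_eq; apply/eqP.
rewrite Rintegral_itvB ?bnd_simp//; apply: Rintegral_itv_obnd_cbnd.
by apply: integrableS fi => //; apply: subset_itvr; rewrite bnd_simp.
Qed.

Definition primitive f x : R := Rintegral mu `[0, x] f - Rintegral mu `[x, 0] f.

Lemma primitive_at0 f : primitive f 0 = 0.
Proof. exact: subrr. Qed.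

Lemma primitive_cst0 : primitive (fun=> 0) = fun=> 0.
Proof.
by apply/funext => x; rewrite /primitive !Rintegral_cst ?mul0r ?subrr//;
  exact: measurable_itv.
Qed.

Lemma primitiveE f a x : continuous f -> a <= 0 -> a <= x ->
  primitive f x = Rintegral mu `[a, x] f - Rintegral mu `[a, 0] f.
Proof.
move=> cf a0 ax; have fi b := continuous_itv_integrable a b cf.
rewrite /primitive; have [x0|/ltW x0] := leP 0 x.
  by rewrite (Rintegral_itvD (fi x) a0 x0) (Rintegral_itv_ge _ x0); ring.
by rewrite (Rintegral_itvD (fi 0) ax x0) (Rintegral_itv_ge _ x0); ring.
Qed.

Lemma is_derive_primitive f x : continuous f -> is_derive x 1 (primitive f) (f x).
Proof.
move=> cf; pose a : R := - (`|x| + 1).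
have a0 : a <= 0 by rewrite oppr_le0 addr_ge0.
have ax : a < x by have := ler_norm (- x); rewrite normrN /a; lra.
apply: (@near_eq_is_derive _ _ _
  (fun t => Rintegral mu `[a, t] f - Rintegral mu `[a, 0] f)).
  by near=> t; rewrite (primitiveE cf a0)// ltW//; near: t; exact: lt_nbhsr.
have [|derivable_int int_val] :=
    continuous_FTC1_closed _ (continuous_itv_integrable a (x + 1) cf) ax (cf x).
  by rewrite ltrDl.
rewrite -int_val -[X in is_derive _ _ _ X]addr0.
exact: (is_derive_add (derivable1P derivable_int) (is_derive_cst _ _ _)).
Unshelve. all: by end_near. Qed.

Lemma continuous_primitive f : continuous f -> continuous (primitive f).
Proof. by move=> cf x; exact: is_derive_continuous (is_derive_primitive x cf). Qed.

End Primitive.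

Section GeometricConvergence.
Variable R : realType.

Lemma cvg_geometric_half (C : R) : C / 2 ^+ n @[n --> \oo] --> (0 : R).
Proof.
under eq_fun do rewrite -exprVn.
by apply: cvg_geometric; rewrite ger0_norm// invf_lt1// ltr1n.
Qed.

Lemma geometric_dist_cvg (u : nat -> R) (C l : R) :
  (forall n, `|u n - l| <= C / 2 ^+ n) -> u n @[n --> \oo] --> l.
Proof.
move=> u_l; apply/cvgrPdist_le => e e0.
move/cvgr_le : (cvg_geometric_half C) => /(_ _ e0); apply: filterS => n C_le.
by rewrite distrC (le_trans (u_l n)).
Qed.

Lemma geometric_steps_dist_lim (u : nat -> R) (C : R) :
  (forall n, `|u n.+1 - u n| <= C / 2 ^+ n.+1) ->
  forall n, `|u n - limn u| <= C / 2 ^+ n.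
Proof.
move=> steps.
have half n : C / 2 ^+ n = C / 2 ^+ n.+1 + C / 2 ^+ n.+1.
  by rewrite exprS; field; rewrite expf_neq0.
have C0 : 0 <= C by have := le_trans (normr_ge0 _) (steps 0%N); rewrite expr1; lra.
have tail n k : `|u n - u (n + k)%N| <= C / 2 ^+ n - C / 2 ^+ (n + k).
  elim: k => [|k IHk]; first by rewrite addn0 !subrr normr0.
  rewrite addnS (le_trans (ler_distD (u (n + k)%N) _ _))//.
  have step := steps (n + k)%N; rewrite distrC in step.
  by apply: (le_trans (lerD IHk step)); rewrite (half (n + k)%N); lra.
have tail_le n k : `|u n - u (n + k)%N| <= C / 2 ^+ n.
  by rewrite (le_trans (tail n k))// gerBl divr_ge0// exprn_ge0.
have cu : cvgn u.
  apply/cauchy_cvgP/cauchy_exP => e e0.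
  have [N _ /(_ N (leqnn N)) C_lt] := cvgr_lt _ (cvg_geometric_half C) _ e0.
  by exists (u N); exists N => // n /= /subnKC <-; exact: le_lt_trans (tail_le _ _) C_lt.
move=> n; have shifted : u (n + k)%N @[k --> \oo] --> limn u.
  by move: cu; rewrite -(cvg_shiftn n u) /=; under eq_fun do rewrite addnC.
have : `|u n - u (n + k)%N| @[k --> \oo] --> `|u n - limn u|.
  by apply: cvg_norm; apply: cvgB shifted; exact: cvg_cst.
move=> /[dup] /cvg_lim <- // /cvgP c; apply: limr_le => //.
exact: nearW (tail_le n).
Qed.

Lemma geometric_dist_continuous (u : nat -> R -> R) (y B : R -> R) :
  (forall n, continuous (u n)) -> continuous B ->
  (forall n x, `|u n x - y x| <= B x / 2 ^+ n) -> continuous y.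
Proof.
move=> cu cB u_y /= x; apply/cvgrPdist_lt => /= e e0.
have e3 : 0 < e / 3 by rewrite divr_gt0.
have [n _ /(_ n (leqnn n)) /= nB] := cvgr_lt _ (cvg_geometric_half (B x + 1)) _ e3.
near=> t.
have u_near : `|u n x - u n t| < e / 3.
  by near: t; move/cvgrPdist_lt : (cu n x); exact.
have Bt : B t < B x + 1.
  by near: t; apply: (cvgr_lt _ (cB x)); rewrite ltrDl.
have dist_lt s : B s <= B x + 1 -> `|u n s - y s| < e / 3.
  move=> Bs; rewrite (le_lt_trans (u_y n s))// (le_lt_trans _ nB)//.
  by rewrite ler_wpM2r// invr_ge0 exprn_ge0.
have -> : y x - y t = (u n x - u n t) + (u n t - y t) - (u n x - y x) by ring.
rewrite (le_lt_trans (ler_normB _ _))// [ltRHS](_ : _ = (e / 3 + e / 3) + e / 3); last lra.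
rewrite ltrD ?dist_lt ?lerDl// (le_lt_trans (ler_normD _ _))// ltrD// dist_lt//.
exact: ltW.
Unshelve. all: by end_near. Qed.

End GeometricConvergence.

Section HillExistence.
Variable R : realType.
Implicit Types (f g h u v : R -> R) (x : R).

(* The weight making Picard's map a contraction on the whole line. *)
Definition two_cosh x : R := expR x + expR (- x).

Lemma two_cosh_gt0 x : 0 < two_cosh x.
Proof. by rewrite addr_gt0 ?expR_gt0. Qed.

Lemma two_cosh_ge1 x : 1 <= two_cosh x.
Proof.
rewrite /two_cosh; have [x0|/ltW x0] := leP 0 x.
  by rewrite -[1]addr0 lerD ?expR_ge0// -expR0 ler_expR.
by rewrite -[1]add0r lerD ?expR_ge0// -expR0 ler_expR oppr_ge0.
Qed.

Lemma norm_le_two_cosh x : `|x| <= two_cosh x.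
Proof.
have := expR_ge1Dx x; have := expR_ge1Dx (- x).
have := expR_gt0 x; have := expR_gt0 (- x).
by rewrite /two_cosh ler_norml; lra.
Qed.

Lemma is_derive2_ge0_ge f df ddf : (forall x, is_derive x 1 f (df x)) ->
  (forall x, is_derive x 1 df (ddf x)) -> df 0 = 0 -> (forall x, 0 <= ddf x) ->
  forall x, f 0 <= f x.
Proof.
suff right_half g dg ddg : (forall x, is_derive x 1 g (dg x)) ->
    (forall x, is_derive x 1 dg (ddg x)) -> dg 0 = 0 -> (forall x, 0 <= ddg x) ->
    forall x, 0 <= x -> g 0 <= g x.
  move=> f_df df_ddf df0 ddf_ge0 x.
  have [|x0] := leP 0 x; first exact: right_half ddf_ge0 x.
  have := @right_half (fun t => f (- t)) (fun t => - df (- t)) (fun t => ddf (- t)).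
  move=> /(_ _ _ _ _ (- x)); rewrite opprK oppr0; apply => //.
  - by move=> t; derive; ring.
  - by move=> t; derive; ring.
  - by rewrite df0 oppr0.
  - by rewrite oppr_ge0 ltW.
move=> g_dg dg_ddg dg0 ddg_ge0 x x0; apply: (is_derive_ge0_le x0 g_dg) => t /andP[t0 _].
by rewrite -dg0; apply: (is_derive_ge0_le t0 dg_ddg) => s _; exact: ddg_ge0.
Qed.

Lemma is_derive2_le_two_cosh h dh f (M K : R) : 0 < K -> 0 <= M ->
  (forall x, is_derive x 1 h (dh x)) -> (forall x, is_derive x 1 dh (f x)) ->
  h 0 = 0 -> dh 0 = 0 -> (forall x, `|f x| <= M * two_cosh (K * x)) ->
  forall x, `|h x| <= M / K ^+ 2 * two_cosh (K * x).
Proof.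
move=> K0 M0 h_dh dh_f h0 dh0 fM x; have Kneq0 : K != 0 by rewrite gt_eqF.
have bound (s : R) : s = 1 \/ s = -1 -> s * h x <= M / K ^+ 2 * two_cosh (K * x).
  move=> s1; rewrite -subr_ge0.
  apply: le_trans (_ : M / K ^+ 2 * two_cosh (K * 0) - s * h 0 <= _).
    rewrite h0 [s * 0]mulr0 subr0 mulr_ge0 ?(ltW (two_cosh_gt0 _))//.
    by rewrite divr_ge0// sqr_ge0.
  apply: (@is_derive2_ge0_ge (fun t => M / K ^+ 2 * two_cosh (K * t) - s * h t)
    (fun t => M / K * (expR (K * t) - expR (- (K * t))) - s * dh t)
    (fun t => M * two_cosh (K * t) - s * f t)).
  - by move=> t; rewrite /two_cosh; derive; field.
  - by move=> t; rewrite /two_cosh; derive; field.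
  - by rewrite dh0 !mulr0 oppr0; ring.
  - move=> t; have := fM t; rewrite ler_norml subr_ge0 => /andP[].
    by case: s1 => ->; lra.
by rewrite ler_norml lerNl -mulN1r -[X in _ && (X <= _)]mul1r !bound //; [left|right].
Qed.

Definition picard (q : R -> R) (a b : R) u x : R :=
  a + b * x - primitive (primitive (fun t => q t * u t)) x.

Definition picard_iter (q : R -> R) (a b : R) n : R -> R := iter n (picard q a b) (fun=> 0).

Definition picard_lim (q : R -> R) (a b : R) x : R := limn (picard_iter q a b ^~ x).

Section Picard.
Variables (q : R -> R) (Q a b : R).
Hypothesis cq : continuous q.
Hypothesis qQ : forall x, `|q x| <= Q.

Let K : R := 1 + 2 * Q.
Let C : R := 2 * (`|a| + `|b|).
Notation iterate := (picard_iter q a b).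
Notation solution := (picard_lim q a b).

Let Q0 : 0 <= Q. Proof. exact: le_trans (qQ 0). Qed.
Let K1 : 1 <= K. Proof. by have := Q0; rewrite /K; lra. Qed.
Let C0 : 0 <= C. Proof. by rewrite mulr_ge0// addr_ge0. Qed.

Let continuous_qM u : continuous u -> continuous (fun x => q x * u x).
Proof. by move=> cu x; apply: cvgM; [exact: cq|exact: cu]. Qed.

Lemma is_derive_picard u x : continuous u ->
  is_derive x 1 (picard q a b u) (b - primitive (fun t => q t * u t) x).
Proof.
move=> /continuous_qM cqu; have pu := is_derive_primitive x (continuous_primitive cqu).
by rewrite /picard; derive; ring.
Qed.

Lemma continuous_picard u : continuous u -> continuous (picard q a b u).
Proof. by move=> cu x; exact: is_derive_continuous (is_derive_picard x cu). Qed.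

Lemma picard_contraction u v (M : R) : continuous u -> continuous v -> 0 <= M ->
  (forall x, `|u x - v x| <= M * two_cosh (K * x)) ->
  forall x, `|picard q a b u x - picard q a b v x| <= M / 2 * two_cosh (K * x).
Proof.
move=> cu cv M0 uv x; have [cqu cqv] := (continuous_qM cu, continuous_qM cv).
apply: (@le_trans _ _ (Q * M / K ^+ 2 * two_cosh (K * x))); last first.
  rewrite ler_pM2r ?two_cosh_gt0// mulrAC mulrC ler_wpM2l//.
  rewrite ler_pdivrMr ?exprn_gt0 ?(lt_le_trans _ K1)//.
  by have := Q0; rewrite /K; nra.
apply: (@is_derive2_le_two_cosh
  (fun x => picard q a b u x - picard q a b v x)
  (fun x => - (primitive (fun t => q t * u t) x - primitive (fun t => q t * v t) x))
  (fun x => - (q x * u x - q x * v x))).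
- exact: lt_le_trans K1.
- exact: mulr_ge0.
- move=> t; have pu := is_derive_picard t cu; have pv := is_derive_picard t cv.
  apply: (is_derive_eq (is_derive_add pu (is_derive_opp pv))).
  by rewrite !opprB addrC addrA subrK.
- move=> t; have pu := is_derive_primitive t cqu.
  by have pv := is_derive_primitive t cqv; derive.
- by rewrite /picard !primitive_at0 !subrr.
- by rewrite !primitive_at0 subrr oppr0.
- by move=> t; rewrite normrN -mulrBr normrM -mulrA ler_pM.
Qed.

Lemma continuous_picard_iter n : continuous (iterate n).
Proof.
elim: n => [|n IHn]; first by move=> x; exact: cvg_cst.
exact: continuous_picard.
Qed.

Lemma picard_iter_step n x :
  `|iterate n.+1 x - iterate n x| <= C / 2 ^+ n.+1 * two_cosh (K * x).
Proof.
elim: n x => [|n IHn] x.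
  rewrite /picard_iter /= /picard.
  under [X in primitive (primitive X)]eq_fun do rewrite mulr0.
  rewrite !primitive_cst0 !subr0 expr1 /C [2 * _ / 2]mulrAC divff// mul1r mulrDl.
  rewrite (le_trans (ler_normD _ _))// lerD//.
    by rewrite ler_peMr// two_cosh_ge1.
  rewrite normrM ler_wpM2l// (le_trans _ (norm_le_two_cosh _))// normrM.
  by rewrite ler_peMl// (le_trans K1) ?ler_norm.
rewrite [C / _](_ : _ = C / 2 ^+ n.+1 / 2); last first.
  by rewrite [2 ^+ n.+2]exprS; field; rewrite expf_neq0.
apply: picard_contraction IHn _; try exact: continuous_picard_iter.
by rewrite divr_ge0// exprn_ge0.
Qed.

Lemma picard_iter_dist_lim n x :
  `|iterate n x - solution x| <= C / 2 ^+ n * two_cosh (K * x).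
Proof.
rewrite mulrAC; apply: (@geometric_steps_dist_lim _ (iterate ^~ x)) => m.
by rewrite mulrAC picard_iter_step.
Qed.

Lemma continuous_picard_lim : continuous solution.
Proof.
apply: (geometric_dist_continuous continuous_picard_iter
  (B := fun x => C * two_cosh (K * x))).
  move=> x.
  apply: (@is_derive_continuous _ _ _ (C * (K * (expR (K * x) - expR (- (K * x)))))).
  by rewrite /two_cosh; derive; ring.
by move=> n x; rewrite mulrAC picard_iter_dist_lim.
Qed.

Lemma picard_lim_fixed : picard q a b solution = solution.
Proof.
apply/funext => x.
have to_solution : iterate n x @[n --> \oo] --> solution x.
  apply: (@geometric_dist_cvg _ _ (C * two_cosh (K * x))) => n.
  by rewrite mulrAC picard_iter_dist_lim.
have to_picard : iterate n.+1 x @[n --> \oo] --> picard q a b solution x.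
  apply: (@geometric_dist_cvg _ _ (C / 2 * two_cosh (K * x))) => n.
  rewrite [leRHS](_ : _ = C / 2 ^+ n / 2 * two_cosh (K * x)); last by ring.
  apply: picard_contraction (picard_iter_dist_lim n) _ => //.
  - exact: continuous_picard_iter.
  - exact: continuous_picard_lim.
  - by rewrite divr_ge0// exprn_ge0.
rewrite (cvg_shiftS (iterate ^~ x)) in to_picard.
exact: cvg_unique to_picard to_solution.
Qed.

Lemma hill_sol_exists : exists y dy, [/\ hill_sol q y dy, y 0 = a & dy 0 = b].
Proof.
have cqy := continuous_qM continuous_picard_lim.
exists solution, (fun x => b - primitive (fun t => q t * solution t) x); split.
- split=> x; last first.
    by have p := is_derive_primitive x cqy; derive; ring.
  apply: (eq_is_derive (fun t => congr1 (@^~ t) picard_lim_fixed)).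
  exact: is_derive_picard continuous_picard_lim.
- by rewrite -picard_lim_fixed /picard primitive_at0 mulr0 addr0 subr0.
- by rewrite primitive_at0 subr0.
Qed.

End Picard.

End HillExistence.

Section PerturbedOscillator.
Variable R : realType.
Variables (c y dy : R -> R) (om a : R).
Hypothesis om0 : 0 < om.
Hypothesis a0 : 0 < a.
Hypothesis ca : forall x, `|c x| <= a.
Hypothesis sol_y : hill_sol (fun x => om ^+ 2 + c x) y dy.

Lemma oscillator_energy s t : s <= t ->
  dy t ^+ 2 + om ^+ 2 * y t ^+ 2 <=
  (dy s ^+ 2 + om ^+ 2 * y s ^+ 2) * expR (a / om * (t - s)).
Proof.
move=> st; have [y_dy dy_ddy] := sol_y.
have := @gronwall R (fun x => dy x ^+ 2 + om ^+ 2 * y x ^+ 2)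
  (fun x => - 2 * c x * y x * dy x) (a / om) 0 s t.
rewrite mul0r !addr0; apply; first exact: divr_gt0.
- exact: st.
- by move=> x; under eq_fun do rewrite !expr2; derive; ring.
move=> x _; rewrite addr0.
have := norm_mul2_le (om * y x) (dy x) (ca x); rewrite ler_norml => /andP[+ _].
by rewrite [a / om * _]mulrAC ler_pdivlMr//; lra.
Qed.

Hypothesis y0 : y 0 = 0.
Hypothesis dy0 : dy 0 = 1.

Lemma oscillator_amplitude_le x : 0 <= x -> om * `|y x| <= (1 + expR (a / om * x)) / 2.
Proof.
move=> x0; have := oscillator_energy x0.
rewrite y0 dy0 subr0 expr0n mulr0 expr1n addr0 mul1r -[y x ^+ 2]real_normK ?num_real//.
move: `|y x| => u; have := sqr_ge0 (dy x); have := sqr_ge0 (1 - om * u); lra.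
Qed.

Lemma oscillator_phase_ge x : 0 <= x ->
  1 - a * (1 + expR (a / om * x)) / (2 * om) * x <=
  dy x * cos (om * x) + om * y x * sin (om * x).
Proof.
move=> x0; have [y_dy dy_ddy] := sol_y.
set D := _ / (2 * om).
(* Without the perturbation [c], the first two terms would be constant. *)
pose F t := dy t * cos (om * t) + om * y t * sin (om * t) + D * t.
have : F 0 <= F x.
  apply: (@is_derive_ge0_le _ F (fun t => D - c t * y t * cos (om * t))) => //.
    by move=> t; rewrite /F; derive; ring.
  move=> t /andP[t0 tx]; rewrite subr_ge0 (le_trans (ler_norm _))// !normrM.
  rewrite (@le_trans _ _ (a * `|y t|))//.
    by rewrite -mulrA ler_pM// ler_piMr// cos_max.
  rewrite /D -[leRHS]mulrA ler_wpM2l//; first exact: ltW.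
  rewrite invfM mulrA ler_pdivlMr// mulrC (le_trans (oscillator_amplitude_le t0))//.
  by rewrite ler_pM2r// lerD2l ler_expR ler_pM2l// divr_gt0.
by rewrite /F y0 dy0 !mulr0 cos0 sin0 !mulr0 !addr0 mulr1; lra.
Qed.

Lemma oscillator_sign_pi (n : nat) : om = n%:R + 1 / 2 ->
  pi * a * (1 + expR 1) <= om -> 0 < (-1) ^+ n * y pi.
Proof.
move=> omE om_large; have pi0 := pi_gt0 R.
have e0 : 0 < expR 1 :> R := expR_gt0 1.
have pia0 : 0 < pi * a by rewrite mulr_gt0.
have rate_le1 : a / om * pi <= 1.
  rewrite mulrAC ler_pdivrMr// mul1r mulrC (le_trans _ om_large)//.
  by rewrite ler_peMr ?ltW//; lra.
have := oscillator_phase_ge (ltW pi0).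
have -> : om * pi = pi / 2 + pi *+ n by rewrite omE -mulr_natl; ring.
rewrite (alternatingn (@sinDpi R)) (alternatingn (@cosDpi R)) sin_pihalf cos_pihalf.
rewrite !mulr0 add0r mulr1; set s := (-1) ^+ n => phase_ge.
have small : a * (1 + expR (a / om * pi)) / (2 * om) * pi <= 1 / 2.
  rewrite [leLHS](_ : _ = pi * a * (1 + expR (a / om * pi)) / om / 2); last first.
    by field; rewrite gt_eqF.
  rewrite ler_pM2r// ler_pdivrMr// mul1r (le_trans _ om_large)//.
  by rewrite ler_pM2l// lerD2l ler_expR.
have : 0 < om * (s * y pi) by lra.
by rewrite pmulr_rgt0.
Qed.

End PerturbedOscillator.

(** * Infinitely many periodic eigenvalues *)

Section MathieuSpectrum.
Variable R : realType.
Variable alpha : R.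
Implicit Types (y dy : R -> R) (lam : R).

Definition mathieu_pot lam (x : R) : R := lam + alpha * cos (2 * x).

Lemma mathieu_pot_bound lam x : `|mathieu_pot lam x| <= `|lam| + `|alpha|.
Proof.
rewrite /mathieu_pot (le_trans (ler_normD _ _))// lerD2l normrM ler_piMr//.
exact: cos_max.
Qed.

Lemma mathieu_potN lam x : mathieu_pot lam (- x) = mathieu_pot lam x.
Proof. by rewrite /mathieu_pot mulrN cosN. Qed.

Lemma mathieu_pot_periodic lam (t : R) : sin t = 0 -> periodic (mathieu_pot lam) t.
Proof.
move=> sin_t x.
have sin2t : sin (2 * t) = 0 by rewrite mulr_natl sin_mulr2n sin_t mulr0 mul0rn.
have cos2t : cos (2 * t) = 1.
  by rewrite mulr_natl cos_mulr2n cos2sin2 sin_t expr0n /= subr0; ring.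
by rewrite /mathieu_pot mulrDr cosD sin2t cos2t mulr1 mulr0 subr0.
Qed.

Lemma is_derive_mathieu_pot lam (x : R) :
  is_derive x 1 (mathieu_pot lam) (- 2 * alpha * sin (2 * x)).
Proof. by rewrite /mathieu_pot; derive; ring. Qed.

Lemma continuous_mathieu_pot lam : continuous (mathieu_pot lam).
Proof. by move=> x; exact: is_derive_continuous (is_derive_mathieu_pot lam x). Qed.

Lemma mathieu_sol_hill lam y : mathieu_sol alpha lam y ->
  hill_sol (mathieu_pot lam) y (derive1 y).
Proof.
move=> [y_dy [dy_ddy y_eq]]; split => x; first exact: derivable1P.
rewrite (_ : - _ = derive1 (derive1 y) x); first exact: derivable1P.
by have := y_eq x; rewrite /mathieu_pot; lra.
Qed.

Lemma hill_mathieu_sol lam y dy : hill_sol (mathieu_pot lam) y dy ->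
  mathieu_sol alpha lam y.
Proof.
move=> [y_dy dy_ddy].
have dyE : derive1 y = dy by apply/funext => x; exact: derive1_val.
split; first by move=> x; exact: ex_derive.
rewrite dyE; split => x; first exact: ex_derive.
by rewrite (derive1_val (dy_ddy x)) addNr.
Qed.

Definition dirichlet_sol lam y dy :=
  [/\ hill_sol (mathieu_pot lam) y dy, y 0 = 0 & dy 0 = 1].

Lemma dirichlet_sol_continuous (Y dY : R -> R -> R) :
  (forall lam, dirichlet_sol lam (Y lam) (dY lam)) -> continuous (fun lam => Y lam pi).
Proof.
move=> sol_Y lam0; pose Q := `|lam0| + 1 + `|alpha|.
pose B := expR ((2 + Q) * (pi - 0)).
have B0 : 0 < B by exact: expR_gt0.
have [sol0 Y0 dY0] := sol_Y lam0.
have potQ lam : `|lam0 - lam| < 1 -> forall x, `|mathieu_pot lam x| <= Q.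
  move=> near x; rewrite (le_trans (mathieu_pot_bound _ _))// lerD2r.
  by rewrite -lerBlDl (le_trans (lerB_dist _ _))// distrC ltW.
have lipschitz lam : `|lam0 - lam| < 1 -> `|Y lam0 pi - Y lam pi| <= B * `|lam0 - lam|.
  move=> near; have [sol1 Y1 dY1] := sol_Y lam.
  have pot_dist x : `|mathieu_pot lam0 x - mathieu_pot lam x| <= `|lam0 - lam|.
    by rewrite /mathieu_pot opprD addrACA subrr addr0.
  have potQ0 : forall x, `|mathieu_pot lam0 x| <= Q by apply: potQ; rewrite subrr normr0.
  have := hill_sol_stability potQ0 (potQ _ near) pot_dist sol0 sol1 _ _ (pi_ge0 R).
  rewrite Y0 Y1 dY0 dY1 expr0n expr1n add0r mul1r -/B => /(_ erefl erefl).
  move=> dist_le; rewrite distrC mulrC -ler_sqr ?nnegrE ?mulr_ge0 ?(ltW B0)//.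
  by rewrite real_normK ?num_real.
apply/cvgrPdist_lt => /= e e0; near=> lam.
apply: (le_lt_trans (lipschitz lam _)); first by near: lam; exists 1 => //=.
rewrite mulrC -ltr_pdivlMr//.
by near: lam; exists (e / B) => //=; rewrite divr_gt0.
Unshelve. all: by end_near. Qed.

Lemma dirichlet_sol_sign y dy (n : nat) : dirichlet_sol ((n%:R + 1 / 2) ^+ 2) y dy ->
  pi * (`|alpha| + 1) * (1 + expR 1) <= n%:R + 1 / 2 :> R ->
  0 < (-1) ^+ n * y pi.
Proof.
move=> [sol_y y0 dy0] n_large.
apply: (@oscillator_sign_pi _ (fun x => alpha * cos (2 * x)) _ dy (n%:R + 1 / 2)
  (`|alpha| + 1)) => //.
move=> x; rewrite (@le_trans _ _ `|alpha|) ?lerDl// normrM ler_piMr//.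
exact: cos_max.
Qed.

Lemma dirichlet_sol_exists lam : exists y dy, dirichlet_sol lam y dy.
Proof.
by apply: hill_sol_exists; [exact: continuous_mathieu_pot|exact: mathieu_pot_bound].
Qed.

Lemma dirichlet_eigenvalue_unbounded (M : R) :
  exists2 lam, M <= lam & exists y dy, dirichlet_sol lam y dy /\ y pi = 0.
Proof.
have [Y /choice[dY sol_Y]] := choice dirichlet_sol_exists.
pose om k : R := k%:R + 1 / 2.
pose bound : R := pi * (`|alpha| + 1) * (1 + expR 1) + `|M| + 1.
have bound_ge : `|M| + 1 <= bound.
  by rewrite /bound -addrA lerDr !mulr_ge0 ?pi_ge0// addr_ge0// expR_ge0.
have [n n_large] : exists n : nat, bound < n%:R.
  by exists (Num.Def.truncn bound).+1; exact: truncnS_gt.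
have sign k : (n <= k)%N -> 0 < (-1) ^+ k * Y (om k ^+ 2) pi.
  move=> nk; apply: (dirichlet_sol_sign (sol_Y _)).
  rewrite -(ler_nat R) in nk; have := normr_ge0 M.
  by move: n_large; rewrite /bound; lra.
have om_mono : om n ^+ 2 <= om n.+1 ^+ 2.
  have om_ge0 k : 0 <= om k by rewrite addr_ge0 ?divr_ge0.
  by rewrite ler_sqr ?nnegrE// lerD2r ler_nat.
have [||lam] := @IVT R (fun lam => Y lam pi) _ _ 0 om_mono.
- by apply: continuous_subspaceT; exact: dirichlet_sol_continuous sol_Y.
- move: (sign n (leqnn n)) (sign n.+1 (leqnSn n)).
  move: (Y (om n ^+ 2) pi) (Y (om n.+1 ^+ 2) pi) => u v.
  rewrite exprS -signr_odd ge_min le_max.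
  by case: (odd n); rewrite /= ?expr0 ?expr1 => u_sign v_sign; apply/andP; split;
    apply/orP; (left; lra) || (right; lra).
- rewrite in_itv /= => /andP[lam_ge _] Ypi; exists lam; last by exists (Y lam), (dY lam).
  have n_gt1 : 1 < n%:R :> R by have := normr_ge0 M; lra.
  apply: le_trans lam_ge; apply: (@le_trans _ _ (om n)).
    by have := ler_norm M; rewrite /om; lra.
  by rewrite expr2 ler_peMl// /om; lra.
Qed.

Lemma mathieu_periodic_infinite : infinite_set [set lam : R | exists y : R -> R,
  mathieu_sol alpha lam y /\ periodic2pi y /\ exists x, y x != 0].
Proof.
move=> /finite_compact /compact_bounded [M [_ Mb]].
have [lam lamM [y [dy [[sol_y y0 dy0] ypi]]]] := dirichlet_eigenvalue_unbounded (M + 2).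
suff /(Mb (M + 1) ltac:(lra)) : [set lam : R | exists y : R -> R,
    mathieu_sol alpha lam y /\ periodic2pi y /\ exists x, y x != 0] lam.
  by rewrite /=; have := ler_norm lam; lra.
exists y; split; first exact: hill_mathieu_sol sol_y.
split.
  rewrite /periodic2pi mulr_natl.
  exact: hill_dirichlet_periodic (mathieu_pot_bound _) (mathieu_potN _)
    (mathieu_pot_periodic _ (sinpi R)) sol_y y0 ypi.
apply: contrapT => /forallNP y_trivial.
have y_cst0 : y = cst 0 by apply/funext => x; apply: contrapT => /eqP; exact: y_trivial.
have := derive1_val (sol_y.1 0); rewrite dy0 y_cst0 derive1_cst => /eqP.
by rewrite eq_sym oner_eq0.
Qed.

End MathieuSpectrum.

(** * Functions of two variables *)

Section Slices.
Variables T U V : topologicalType.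

Lemma pairl_continuous (y : U) : continuous (fun t : T => (t, y)).
Proof.
by move=> x; apply: (@cvg_pair _ _ _ _ (nbhs x) (nbhs y)); [exact: cvg_id|exact: cvg_cst].
Qed.

Lemma pairr_continuous (x : T) : continuous (fun t : U => (x, t)).
Proof.
by move=> y; apply: (@cvg_pair _ _ _ _ (nbhs x) (nbhs y)); [exact: cvg_cst|exact: cvg_id].
Qed.

Lemma continuous_slicel (F : T -> U -> V) y :
  continuous (fun z : T * U => F z.1 z.2) -> continuous (F ^~ y).
Proof. by move=> cF x; exact: (cvg_comp _ _ (@pairl_continuous y x) (cF (x, y))). Qed.

Lemma continuous_slicer (F : T -> U -> V) x :
  continuous (fun z : T * U => F z.1 z.2) -> continuous (F x).
Proof. by move=> cF y; exact: (cvg_comp _ _ (@pairr_continuous x y) (cF (x, y))). Qed.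

End Slices.

Section ProductMeasurability.
Variable R : realType.
Notation TR := (measurableTypeR R).

Lemma rat_itvoo_nbhs (x : R) (A : set R) : nbhs x A ->
  exists q : rat * rat, ratr q.1 < x < ratr q.2 /\
    forall t : R, ratr q.1 < t < ratr q.2 -> A t.
Proof.
move=> [e /= e0 eA].
have [a] := @rat_in_itvoo R (x - e) x ltac:(by rewrite ltrBlDr ltrDl).
have [b] := @rat_in_itvoo R x (x + e) ltac:(by rewrite ltrDl).
rewrite !in_itv /= => /andP[xb bxe] /andP[xea ax].
exists (a, b); rewrite ax xb; split=> // t /andP[at_ tb].
by apply: eA; rewrite /= distrC ltr_norml; lra.
Qed.

Lemma open_measurable_prod (U : set (R * R)) : open U ->
  @measurable _ (TR * TR)%type U.
Proof.
pose box (q : (rat * rat) * (rat * rat)) : set (R * R) :=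
  `]ratr q.1.1, ratr q.1.2[%classic `*` `]ratr q.2.1, ratr q.2.2[%classic.
move=> openU.
have -> : U = \bigcup_(q in [set q | box q `<=` U]) box q.
  apply/seteqP; split=> [[x y] Uxy|z [q] /=]; last exact.
  have [[A B] /= [Ax By] ABU] := openU _ Uxy.
  have [[p [xp pA]] [q [yq qB]]] := (rat_itvoo_nbhs Ax, rat_itvoo_nbhs By).
  exists (p, q); rewrite /box /=; last by rewrite !in_itv.
  by move=> z /=; rewrite !in_itv /= => -[/pA Az /qB Bz]; apply: ABU.
rewrite bigcup_mkcond; apply: countable_bigcupT_measurable => // q; case: ifP => // _.
by apply: measurableX; exact: measurable_itv.
Qed.

Lemma continuous_measurable_prod (F : R * R -> R) : continuous F ->
  @measurable_fun _ _ (TR * TR)%type R setT F.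
Proof.
move=> /continuousP cF; apply: (measurability _ (RGenOpens.measurableE R)).
move=> _ [_ [a [b ->] <-]]; rewrite setTI; apply: open_measurable_prod.
exact/cF/interval_open.
Qed.

End ProductMeasurability.

Definition partial2of2 {R : realType} (F : R -> R -> R) x y : R := derive1 (F x) y.

Section ContinuouslyDifferentiable.
Variable R : realType.
Implicit Types (f df ddf : R -> R).

Definition C1 f := (forall x, derivable f x 1) /\ continuous (derive1 f).

Lemma is_derive_C1 f df : (forall x : R, is_derive x 1 f (df x)) -> continuous df -> C1 f.
Proof.
move=> f_df cdf; split=> [x|]; first exact: ex_derive.
by rewrite (_ : derive1 f = df)//; apply/funext => x; exact: derive1_val.
Qed.

Lemma is_derive_C2 f df ddf : (forall x : R, is_derive x 1 f (df x)) ->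
  (forall x : R, is_derive x 1 df (ddf x)) -> continuous ddf -> C2 f.
Proof.
move=> f_df df_ddf cddf; have dfE : derive1 f = df by apply/funext => x; exact: derive1_val.
split; first by move=> x; exact: ex_derive.
by rewrite dfE; exact: is_derive_C1 df_ddf cddf.
Qed.

Lemma C2_C1 f : C2 f -> C1 f.
Proof.
move=> [f_df [df_ddf _]]; split; first exact: f_df.
by move=> x; exact: is_derive_continuous (derivable1P (df_ddf x)).
Qed.

Lemma C1_continuous f : C1 f -> continuous f.
Proof. by move=> [f_df _] x; exact: is_derive_continuous (derivable1P (f_df x)). Qed.

Lemma C1_scale (c : R) f : C1 f -> C1 (fun x => c * f x).
Proof.
move=> [f_d cdf]; apply: (@is_derive_C1 _ (fun x => c * derive1 f x)) => x.
  by have f_df := derivable1P (f_d x); derive; ring.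
by apply: cvgM; [exact: cvg_cst|exact: cdf].
Qed.

Lemma C1_sin : C1 (@sin R).
Proof. by apply: is_derive_C1 => // x; exact: continuous_cos. Qed.

Lemma C2_sin : C2 (@sin R).
Proof.
by apply: (is_derive_C2 (@is_derive_sin R) (@is_derive_cos R)) => x; apply: cvgN;
  exact: continuous_sin.
Qed.

End ContinuouslyDifferentiable.

Section C1Slices.
Variable R : realType.
Implicit Types (F : R -> R -> R) (x : R).

Lemma C1_2_slicer F x : C1_2 F -> C1 (F x).
Proof.
move=> [F_d [_ [_ cFy]]]; split; first by move=> y; exact: (F_d x y).2.
exact: (@continuous_slicer _ _ _ (partial2of2 F) x cFy).
Qed.

Lemma C1_2_partial1_continuous F x : C1_2 F -> continuous (partial1of2 F x).
Proof.
by move=> [_ [_ [cFx _]]]; exact: (@continuous_slicer _ _ _ (partial1of2 F) x cFx).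
Qed.

End C1Slices.

Section DividedDifference.
Variable R : realType.
Implicit Types x y : R.

Lemma near_prod_dist (x0 y0 e : R) : 0 < e ->
  \forall z \near (x0, y0), `|x0 - z.1| < e /\ `|y0 - z.2| < e.
Proof.
move=> e0; have to_x0 : z.1 @[z --> (x0, y0)] --> x0 by exact: cvg_fst.
have to_y0 : z.2 @[z --> (x0, y0)] --> y0 by exact: cvg_snd.
by near=> z; split; near: z; [move/cvgrPdist_lt : to_x0|move/cvgrPdist_lt : to_y0]; exact.
Unshelve. all: by end_near. Qed.

Lemma cvg_prodB x y : z.1 - z.2 @[z --> (x, y)] --> x - y.
Proof. by apply: cvgB; [exact: cvg_fst|exact: cvg_snd]. Qed.

Lemma near_prod_neq x y : x != y -> \forall z \near (x, y), z.1 != z.2.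
Proof.
rewrite -subr_eq0 => xy0; apply: filterS (cvgr_neq0 _ (@cvg_prodB x y) xy0) => z.
by rewrite subr_eq0.
Qed.

Lemma mean_value_continuous (G : R -> R -> R) (g : R -> R) x0 :
  {for x0, continuous g} ->
  (forall x y, exists2 c, `|c - x| <= `|y - x| & G x y = g c) ->
  {for (x0, x0), continuous (fun z => G z.1 z.2)}.
Proof.
move=> cg mean_value; apply/cvgrPdist_lt => /= e e0.
have [c0] := mean_value x0 x0.
rewrite subrr normr0 normr_le0 subr_eq0 => /eqP -> ->.
move/cvgrPdist_lt : cg => /(_ _ e0) [d /= d0 g_near].
have d4 : 0 < d / 4 by lra.
apply: filterS (near_prod_dist x0 x0 d4) => -[x y] /= [x_near y_near].
have [c cx ->] := mean_value x y; apply: g_near => /=.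
have := ler_distD x x0 c; rewrite (distrC x c).
by have := ler_distD x0 y x; rewrite (distrC y x0); lra.
Qed.

Lemma rolle_between (h dh : R -> R) (a b : R) : (forall x, is_derive x 1 h (dh x)) ->
  a != b -> h a = h b -> exists c, [/\ `|c - a| <= `|b - a|, c != b & dh c = 0].
Proof.
move=> h_dh ab hab.
have rolle u v : u < v -> h u = h v -> exists2 c, u < c < v & dh c = 0.
  move=> uv huv; have [||c] := @Rolle R h u v uv _ _ huv.
  - by move=> x _; exact: ex_derive.
  - by apply: derivable_within_continuous => x _; exact: ex_derive.
  rewrite in_itv /= => cuv hc0; exists c => //.
  by rewrite -(derive1_val (h_dh c)) (derive1_val hc0).
have [lt_ab|lt_ba|eq_ab] := ltgtP a b; last by rewrite eq_ab eqxx in ab.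
- have [c /andP[ac cb] dhc] := rolle _ _ lt_ab hab.
  by exists c; split; rewrite ?lt_eqF// !gtr0_norm ?subr_gt0//; lra.
- have [c /andP[bc ca] dhc] := rolle _ _ lt_ba (esym hab).
  by exists c; split; rewrite ?gt_eqF// !ltr0_norm ?subr_lt0//; lra.
Qed.

Variable phi : R -> R.
Hypothesis C2phi : C2 phi.

Notation dphi := (derive1 phi).
Notation ddphi := (derive1 dphi).

Let phi_dphi x : is_derive x 1 phi (dphi x).
Proof. exact/derivable1P/C2phi.1. Qed.
Let dphi_ddphi x : is_derive x 1 dphi (ddphi x).
Proof. exact/derivable1P/C2phi.2.1. Qed.
Let continuous_ddphi : continuous ddphi. Proof. exact: C2phi.2.2. Qed.

Definition divdiff x y : R :=
  if x == y then dphi x else (phi x - phi y) / (x - y).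

Definition ddivdiff x y : R :=
  if x == y then ddphi x / 2 else (dphi x - divdiff x y) / (x - y).

Lemma divdiffxx x : divdiff x x = dphi x.
Proof. by rewrite /divdiff eqxx. Qed.

Lemma divdiffE x y : x != y -> divdiff x y = (phi x - phi y) / (x - y).
Proof. by rewrite /divdiff => /negbTE ->. Qed.

Lemma ddivdiffE x y : x != y -> ddivdiff x y = (dphi x - divdiff x y) / (x - y).
Proof. by rewrite /ddivdiff => /negbTE ->. Qed.

Lemma divdiffC x y : divdiff x y = divdiff y x.
Proof.
rewrite /divdiff eq_sym; case: eqVneq => [->//|_].
by rewrite -(opprB y x) -(opprB (phi y)) invrN mulrNN.
Qed.

Lemma divdiff_mean_value x y : exists2 c, `|c - x| <= `|y - x| & divdiff x y = dphi c.
Proof.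
have [->|xy] := eqVneq x y; first by exists y; rewrite ?divdiffxx.
have xy0 : x - y != 0 by rewrite subr_eq0.
have [|||c [cx _ dc]] :=
  @rolle_between (fun t => phi t - divdiff x y * t) (fun t => dphi t - divdiff x y) x y.
- by move=> t; derive; ring.
- exact: xy.
- by rewrite divdiffE//; field.
by exists c => //; lra.
Qed.

Lemma ddivdiff_mean_value x y :
  exists2 c, `|c - x| <= `|y - x| & ddivdiff x y = ddphi c / 2.
Proof.
have [->|xy] := eqVneq x y; first by exists y; rewrite // /ddivdiff eqxx.
have xy0 : x - y != 0 by rewrite subr_eq0.
have yx0 : y - x != 0 by rewrite subr_eq0 eq_sym.
(* Rolle's theorem for the Taylor expansion of [phi y] at [t]; [k] makes the values
   at [x] and [y] agree. *)
pose k := (phi y - phi x - dphi x * (y - x)) / (y - x) ^+ 2.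
have [|||c [cx cy dc]] := @rolle_between
  (fun t => phi t + dphi t * (y - t) + k * ((y - t) * (y - t)))
  (fun t => (ddphi t - 2 * k) * (y - t)) x y.
- by move=> t; derive; ring.
- exact: xy.
- by rewrite /k; field.
exists c => //; rewrite ddivdiffE// divdiffE//.
move/eqP : dc; rewrite mulf_eq0 (subr_eq0 y) [y == c]eq_sym (negbTE cy) orbF => /eqP dc.
have -> : ddphi c / 2 = k by lra.
by rewrite /k; field; rewrite ?xy0 ?yx0.
Qed.

Lemma is_derive_divdiff_diag x : is_derive x 1 (divdiff ^~ x) (ddivdiff x x).
Proof.
suff quotient : h^-1 *: (divdiff (h + x) x - divdiff x x) @[h --> 0^'] --> ddivdiff x x.
  split; last by apply: cvg_lim => //; under eq_fun do rewrite scaler1.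
  by apply/cvg_ex; exists (ddivdiff x x); under eq_fun do rewrite scaler1.
apply/cvgrPdist_lt => /= e e0.
move/cvgrPdist_lt : (@continuous_ddphi x) => /(_ _ e0) [d /= d0 ddphi_near].
exists d => // h /=; rewrite sub0r normrN => hd hn0.
have -> : h^-1 *: (divdiff (h + x) x - divdiff x x) = ddivdiff x (h + x).
  have xhx : x != h + x by rewrite -subr_eq0 opprD addrCA subrr addr0 oppr_eq0.
  rewrite divdiffC ddivdiffE// divdiffxx /GRing.scale /=.
  have -> : x - (h + x) = - h by ring.
  by field.
have [c cx ->] := ddivdiff_mean_value x (h + x).
rewrite addrK in cx.
have -> : ddivdiff x x = ddphi x / 2 by rewrite /ddivdiff eqxx.
have := ddphi_near c; rewrite /= distrC => /(_ (le_lt_trans cx hd)).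
rewrite -mulrBl normrM [`|2^-1|]ger0_norm//.
by have := normr_ge0 (ddphi x - ddphi c); lra.
Qed.

Lemma is_derive_divdiff x y : is_derive x 1 (divdiff ^~ y) (ddivdiff x y).
Proof.
have [<-|xy] := eqVneq x y; first exact: is_derive_divdiff_diag.
have xy0 : x - y != 0 by rewrite subr_eq0.
apply: (@near_eq_is_derive _ _ _ (fun t => (phi t - phi y) / (t - y))).
  have near_neq : \forall t \near x, t != y.
    exact: (pairl_continuous (near_prod_neq xy)).
  by apply: filterS near_neq => t ty; rewrite divdiffE.
by rewrite ddivdiffE// divdiffE//; derive; [exact: xy0|field].
Qed.

Lemma divdiff_continuous : continuous (fun z : R * R => divdiff z.1 z.2).
Proof.
move=> [x y] /=; have [<-|xy] := eqVneq x y.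
  apply: (mean_value_continuous _ divdiff_mean_value).
  exact: is_derive_continuous (dphi_ddphi x).
have xy0 : x - y != 0 by rewrite subr_eq0.
have cphi := C1_continuous (C2_C1 C2phi).
have to_num : phi z.1 - phi z.2 @[z --> (x, y)] --> phi x - phi y.
  apply: cvgB; apply: continuous_cvg.
  - exact: cphi.
  - exact: cvg_fst.
  - exact: cphi.
  - exact: cvg_snd.
rewrite /prop_for /continuous_at /= divdiffE//.
apply: cvg_trans (cvgM to_num (cvgV xy0 (@cvg_prodB x y))); apply: near_eq_cvg.
by apply: filterS (near_prod_neq xy) => z zxy; rewrite divdiffE.
Qed.

Lemma ddivdiff_continuous : continuous (fun z : R * R => ddivdiff z.1 z.2).
Proof.
move=> [x y] /=; have [<-|xy] := eqVneq x y.
  apply: (@mean_value_continuous _ (fun t => ddphi t / 2)) ddivdiff_mean_value.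
  by apply: cvgM; [exact: continuous_ddphi|exact: cvg_cst].
have xy0 : x - y != 0 by rewrite subr_eq0.
have to_num : dphi z.1 - divdiff z.1 z.2 @[z --> (x, y)] --> dphi x - divdiff x y.
  apply: cvgB (@divdiff_continuous (x, y)); apply: continuous_cvg; last exact: cvg_fst.
  exact: is_derive_continuous (dphi_ddphi x).
rewrite /prop_for /continuous_at /= ddivdiffE//.
apply: cvg_trans (cvgM to_num (cvgV xy0 (@cvg_prodB x y))); apply: near_eq_cvg.
by apply: filterS (near_prod_neq xy) => z zxy; rewrite ddivdiffE.
Qed.

Lemma C1_divdiffl y : C1 (divdiff ^~ y).
Proof.
apply: (is_derive_C1 (is_derive_divdiff ^~ y)).
exact: (continuous_slicel ddivdiff_continuous).
Qed.

End DividedDifference.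

Section LocalC1.
Variable R : realType.
Implicit Types (F G : R -> R -> R) (p : R * R).

Definition C1_at F p : Prop := exists Fx Fy : R -> R -> R,
  [/\ \forall z \near p, is_derive (z.1 : R) 1 (F ^~ z.2) (Fx z.1 z.2) /\
        is_derive (z.2 : R) 1 (F z.1) (Fy z.1 z.2),
      F z.1 z.2 @[z --> p] --> F p.1 p.2,
      Fx z.1 z.2 @[z --> p] --> Fx p.1 p.2 &
      Fy z.1 z.2 @[z --> p] --> Fy p.1 p.2].

Lemma C1_at_C1_2 F : (forall p, C1_at F p) -> C1_2 F.
Proof.
move=> C1F; split=> [x y|].
  have [Fx [Fy [F_d _ _ _]]] := C1F (x, y); have [F_dx F_dy] := nbhs_singleton F_d.
  by split; exact: ex_derive.
split=> [p|]; first by have [Fx [Fy []]] := C1F p.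
split=> p; have [Fx [Fy [F_d _ cFx cFy]]] := C1F p; rewrite /prop_for /continuous_at.
- rewrite (derive1_val (nbhs_singleton F_d).1); apply: cvg_trans cFx.
  by apply: near_eq_cvg; apply: filterS F_d => z [/derive1_val -> _].
- rewrite (derive1_val (nbhs_singleton F_d).2); apply: cvg_trans cFy.
  by apply: near_eq_cvg; apply: filterS F_d => z [_ /derive1_val ->].
Qed.

Lemma near_eq_C1_at F G p : (\forall z \near p, F z.1 z.2 = G z.1 z.2) ->
  C1_at F p -> C1_at G p.
Proof.
move=> FG [Fx [Fy [F_d cF cFx cFy]]]; exists Fx, Fy; split => //.
- apply: filterS2 F_d (near_join FG) => -[x y] /= [F_dx F_dy] near_FG; split.
  + exact: (near_eq_is_derive (pairl_continuous near_FG) F_dx).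
  + exact: (near_eq_is_derive (pairr_continuous near_FG) F_dy).
- rewrite -(nbhs_singleton FG); apply: cvg_trans cF.
  by apply: near_eq_cvg; apply: filterS FG => z ->.
Qed.

Lemma C1_at_cst (c : R) p : C1_at (fun _ _ => c) p.
Proof.
exists (fun _ _ => 0), (fun _ _ => 0); split; try exact: cvg_cst.
by apply: (@nearW _ (nbhs p)) => z; split; exact: is_derive_cst.
Qed.

Lemma C1_at_proj1 p : C1_at (fun x _ => x) p.
Proof.
exists (fun _ _ => 1), (fun _ _ => 0); split; [|exact: cvg_fst|exact: cvg_cst..].
by apply: (@nearW _ (nbhs p)) => z; split; [exact: is_derive_id|exact: is_derive_cst].
Qed.

Lemma C1_at_proj2 p : C1_at (fun _ y => y) p.
Proof.
exists (fun _ _ => 0), (fun _ _ => 1); split; [|exact: cvg_snd|exact: cvg_cst..].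
by apply: (@nearW _ (nbhs p)) => z; split; [exact: is_derive_cst|exact: is_derive_id].
Qed.

Lemma C1_atD F G p : C1_at F p -> C1_at G p -> C1_at (fun x y => F x y + G x y) p.
Proof.
move=> [Fx [Fy [dF cF cFx cFy]]] [Gx [Gy [dG cG cGx cGy]]].
exists (fun x y => Fx x y + Gx x y), (fun x y => Fy x y + Gy x y); split.
- by apply: filterS2 dF dG => z [F_dx F_dy] [G_dx G_dy]; split; exact: is_derive_add.
- exact: cvgD.
- exact: cvgD.
- exact: cvgD.
Qed.

Lemma C1_atM F G p : C1_at F p -> C1_at G p -> C1_at (fun x y => F x y * G x y) p.
Proof.
move=> [Fx [Fy [dF cF cFx cFy]]] [Gx [Gy [dG cG cGx cGy]]].
exists (fun x y => Fx x y * G x y + F x y * Gx x y),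
  (fun x y => Fy x y * G x y + F x y * Gy x y); split.
- by apply: filterS2 dF dG => z [F_dx F_dy] [G_dx G_dy]; split; exact: is_derive_mul.
- exact: cvgM.
- by apply: cvgD; apply: cvgM.
- by apply: cvgD; apply: cvgM.
Qed.

Lemma C1_at_comp_near (f df : R -> R) F p :
  (\forall t \near F p.1 p.2, is_derive (t : R) 1 f (df t)) ->
  {for F p.1 p.2, continuous df} -> C1_at F p -> C1_at (fun x y => f (F x y)) p.
Proof.
move=> f_df cdf [Fx [Fy [dF cF cFx cFy]]].
have cdfF : df (F z.1 z.2) @[z --> p] --> df (F p.1 p.2) by exact: continuous_cvg.
exists (fun x y => df (F x y) * Fx x y), (fun x y => df (F x y) * Fy x y); split.
- apply: filterS2 dF (cF _ f_df) => z [F_dx F_dy] /= f_d.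
  by split; [exact: (is_derive_comp f_d F_dx)|exact: (is_derive_comp f_d F_dy)].
- by apply: continuous_cvg cF; exact: is_derive_continuous (nbhs_singleton f_df).
- exact: cvgM.
- exact: cvgM.
Qed.

Lemma C1_at_comp (f : R -> R) F p : C1 f -> C1_at F p -> C1_at (fun x y => f (F x y)) p.
Proof.
move=> [f_df cdf]; apply: C1_at_comp_near (cdf _).
by apply: (@nearW _ (nbhs (F p.1 p.2))) => t; exact: derivable1P.
Qed.

Lemma C1_atB F G p : C1_at F p -> C1_at G p -> C1_at (fun x y => F x y - G x y) p.
Proof.
move=> C1F C1G; apply: (C1_atD C1F); apply: C1_at_comp C1G.
by apply: (@is_derive_C1 _ _ (fun=> -1)) => x; exact: cvg_cst.
Qed.

Lemma C1_atV F p : F p.1 p.2 != 0 -> C1_at F p -> C1_at (fun x y => (F x y)^-1) p.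
Proof.
move=> Fp0; apply: (@C1_at_comp_near _ (fun t => - (1 / t ^+ 2))).
  apply: filterS (cvgr_neq0 _ (@cvg_id _ (nbhs (F p.1 p.2))) Fp0) => t t0.
  by apply: is_derive_inv t0 _; exact: is_derive_id.
apply: cvgN; apply: cvgM; first exact: cvg_cst.
apply: cvgV; first by rewrite expf_neq0.
exact: exprn_continuous.
Qed.

Lemma C1_at_shift F (t x y : R) : C1_at F (x - t, y) ->
  C1_at (fun u v => F (u - t) v) (x, y).
Proof.
move=> [Fx [Fy [dF cF cFx cFy]]].
exists (fun u v => Fx (u - t) v), (fun u v => Fy (u - t) v).
have shift : (z.1 - t, z.2) @[z --> (x, y)] --> (x - t, y).
  apply: (@cvg_pair _ _ _ _ (nbhs (x - t)) (nbhs y)); last exact: cvg_snd.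
  by apply: cvgB; [exact: cvg_fst|exact: cvg_cst].
split.
- apply: (@filterS _ (nbhs (x, y)) _ _ _ _ (shift _ dF)) => -[u v] /= [F_dx F_dy].
  split; last exact: F_dy.
  have shift_d : is_derive u 1 (fun s => s - t) 1 by derive; ring.
  rewrite -[Fx _ _]mulr1.
  exact: (@is_derive_comp _ (F ^~ v) (fun s => s - t) u _ _ F_dx shift_d).
- exact: (cvg_comp _ _ shift cF).
- exact: (cvg_comp _ _ shift cFx).
- exact: (cvg_comp _ _ shift cFy).
Qed.

Lemma C1_at_divdiff (phi : R -> R) p : C2 phi -> C1_at (divdiff phi) p.
Proof.
move=> C2phi; exists (ddivdiff phi), (fun x y => ddivdiff phi y x); split.
- apply: (@nearW _ (nbhs p)) => z; split; first exact: is_derive_divdiff.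
  exact: (eq_is_derive (fun t => divdiffC phi t z.1) (is_derive_divdiff C2phi z.2 z.1)).
- exact: (@divdiff_continuous _ _ C2phi p).
- exact: (@ddivdiff_continuous _ _ C2phi p).
- exact: (cvg_comp _ _ (@swap_continuous _ _ p)
    (@ddivdiff_continuous _ _ C2phi (p.2, p.1))).
Qed.

End LocalC1.

(** * The kernel *)

Section Sine.
Variable R : realType.
Implicit Types x y t : R.

Lemma sin_neq0 t : `|t| < pi -> t != 0 -> sin t != 0.
Proof.
have pos (s : R) : 0 < s -> s < pi -> sin s != 0.
  by move=> s0 spi; rewrite gt_eqF// sin_gt0_pi// s0.
rewrite ltr_norml => /andP[tNpi tpi]; case: ltgtP => // [t0|t0] _; last exact: pos.
by rewrite -oppr_eq0 -sinN pos ?oppr_gt0// ltrNl.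
Qed.

Lemma sin_eq0_mulrn_pi t : sin t = 0 -> exists n : nat, t = pi *+ n \/ t = - (pi *+ n).
Proof.
have pi0 := pi_gt0 R.
suff nonneg (s : R) : 0 <= s -> sin s = 0 -> exists n : nat, s = pi *+ n.
  move=> sin_t; have [/nonneg/(_ sin_t)[n ->]|t0] := leP 0 t; first by exists n; left.
  have [||n tE] := nonneg (- t); [by rewrite oppr_ge0 ltW|by rewrite sinN sin_t oppr0|].
  by exists n; right; rewrite -tE opprK.
move=> s0; pose n := Num.Def.truncn (s / pi).
have /andP[] : n%:R <= s / pi < n.+1%:R by rewrite truncn_itv// divr_ge0// ltW.
rewrite ler_pdivlMr// ltr_pdivrMr// -natr1 => n_le n_gt.
have -> : s = (s - pi *+ n) + pi *+ n by rewrite subrK.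
rewrite (alternatingn (@sinDpi R)) => /eqP; rewrite mulf_eq0 signr_eq0 /= => sin_r0.
exists n; apply/eqP; rewrite -subr_eq0 addrK; apply: contraTT sin_r0; apply: sin_neq0.
by rewrite -mulr_natl ger0_norm; lra.
Qed.

Lemma sin_eq0_cos_neq0 t : sin t = 0 -> cos t != 0.
Proof. by move=> sin_t; rewrite -normr_eq0 sin0cos1// oner_eq0. Qed.

Lemma sin_eq0_periodic (f : R -> R) t : periodic f (2 * pi) -> sin t = 0 ->
  periodic f (t + t).
Proof.
move=> fp /sin_eq0_mulrn_pi[n tE] x.
have := @periodicn _ _ f _ fp n; rewrite mulr_natl -mulrnA.
case: tE => -> fpn; first by rewrite -mulrnDr addnn -mul2n fpn.
by rewrite -opprD -mulrnDr addnn -mul2n -[in RHS](subrK (pi *+ (2 * n)) x) fpn.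
Qed.

Lemma near_sin_sub_neq0 x y : \forall t \near x^', sin (t - y) != 0.
Proof.
have [sin0|sin_neq] := eqVneq (sin (x - y)) 0; last first.
  have to_sin : sin (t - y) @[t --> x] --> sin (x - y).
    apply: continuous_cvg; first exact: continuous_sin.
    by apply: cvgB; [exact: cvg_id|exact: cvg_cst].
  exact: nbhs_dnbhs (cvgr_neq0 _ to_sin sin_neq).
exists pi => /=; first exact: pi_gt0.
move=> t /= xt_pi tx; rewrite (_ : t - y = (t - x) + (x - y)); last by ring.
rewrite sinD sin0 mulr0 addr0 mulf_neq0 ?sin_eq0_cos_neq0//.
by apply: sin_neq0; rewrite ?subr_eq0// distrC.
Qed.

Lemma cos_doubleB x y : cos (2 * x) - cos (2 * y) = - 2 * sin (x + y) * sin (x - y).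
Proof.
have -> : 2 * x = (x + y) + (x - y) by ring.
have -> : 2 * y = (x + y) - (x - y) by ring.
by move: (x + y) (x - y) => u v; rewrite cosD cosB; ring.
Qed.

End Sine.

Lemma continuous_eq_dnbhs (R : realType) (f g : R -> R) (x : R) :
  {for x, continuous f} -> {for x, continuous g} ->
  (\forall t \near x^', f t = g t) -> f x = g x.
Proof.
move=> cf cg fg; apply: (@cvg_unique _ (@Rhausdorff R) (f t @[t --> x^'])).
  exact: (continuous_withinNx f x).1.
by apply: cvg_trans ((continuous_withinNx g x).1 cg); apply: near_eq_cvg; apply: filterS fg.
Qed.

Section MathieuKernel.
Variable R : realType.
Implicit Types x y t : R.

(* Where [sin (x - y)] vanishes, so does the numerator of [W], and the value is the
   quotient of the derivatives in [x]. *)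
Definition mathieu_kernel (A : R -> R) x y : R := if sin (x - y) == 0
  then (derive1 A x * derive1 A y - derive1 (derive1 A) x * A y) / cos (x - y)
  else (A x * derive1 A y - derive1 A x * A y) / sin (x - y).

Lemma mathieu_kernelE (A : R -> R) x y : sin (x - y) != 0 ->
  mathieu_kernel A x y = (A x * derive1 A y - derive1 A x * A y) / sin (x - y).
Proof. by rewrite /mathieu_kernel => /negbTE ->. Qed.

Variables (alpha lam : R) (A : R -> R).
Hypothesis solA : mathieu_sol alpha lam A.

Notation dA := (derive1 A).
Notation ddA := (derive1 dA).
Notation pot := (mathieu_pot alpha lam).
Notation W := (mathieu_kernel A).

Let A_dA x : is_derive x 1 A (dA x). Proof. exact/derivable1P/solA.1. Qed.
Let dA_ddA x : is_derive x 1 dA (ddA x). Proof. exact/derivable1P/solA.2.1. Qed.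

Lemma mathieu_sol_derive2 : ddA = fun x => - (pot x * A x).
Proof. by apply/funext => x; have := solA.2.2 x; rewrite /mathieu_pot; lra. Qed.

Lemma mathieu_sol_C2 : C2 A.
Proof.
apply: (is_derive_C2 A_dA dA_ddA) => x; rewrite mathieu_sol_derive2; apply: cvgN.
by apply: cvgM; [exact: continuous_mathieu_pot|exact: is_derive_continuous (A_dA x)].
Qed.

Lemma mathieu_sol_derive_C2 : C2 dA.
Proof.
have pot_d := is_derive_mathieu_pot alpha lam.
have ddA_d x : is_derive x 1 ddA (2 * alpha * sin (2 * x) * A x - pot x * dA x).
  by rewrite mathieu_sol_derive2; derive; ring.
apply: (is_derive_C2 dA_ddA ddA_d) => x.
apply: (@is_derive_continuous _ _ _ (4 * alpha * cos (2 * x) * A x +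
  4 * alpha * sin (2 * x) * dA x - pot x * ddA x)).
by derive; ring.
Qed.

Lemma mathieu_kernelC x y : W x y = W y x.
Proof.
rewrite /mathieu_kernel -(opprB x y) sinN oppr_eq0 cosN.
case: eqP => [sin0|/eqP sin_neq]; last by field.
have := mathieu_pot_periodic alpha lam sin0 y; rewrite addrC subrK => potE.
by congr (_ / _); rewrite mathieu_sol_derive2 potE; ring.
Qed.

Lemma mathieu_kernel_diag x y : `|x - y| < pi ->
  W x y = (divdiff A x y * dA y - divdiff dA x y * A y) / divdiff (@sin R) (x - y) 0.
Proof.
move=> xy_pi; have [->|xy] := eqVneq x y.
  rewrite /mathieu_kernel subrr sin0 cos0 eqxx !divdiffxx.
  by rewrite (derive1_val (is_derive_sin _)) cos0; ring.
have xy0 : x - y != 0 by rewrite subr_eq0.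
have sin_xy := sin_neq0 xy_pi xy0.
rewrite mathieu_kernelE// !divdiffE// sin0 !subr0.
by field; rewrite xy0 sin_xy.
Qed.

Lemma mathieu_kernel_C1_regular x y : sin (x - y) != 0 -> C1_at W (x, y).
Proof.
move=> sin_xy; have CA := C2_C1 mathieu_sol_C2; have CdA := C2_C1 mathieu_sol_derive_C2.
have C1_at_sin : C1_at (fun u v => sin (u - v)) (x, y).
  apply: (C1_at_comp (@C1_sin R)); apply: C1_atB; [exact: C1_at_proj1|exact: C1_at_proj2].
apply: (@near_eq_C1_at _ (fun u v => (A u * dA v - dA u * A v) * (sin (u - v))^-1)).
  have [_ [_ [_ cs _ _]]] := C1_at_sin.
  by apply: filterS (cvgr_neq0 _ cs sin_xy) => z z0; rewrite mathieu_kernelE.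
apply: C1_atM; last exact: C1_atV.
by apply: C1_atB; apply: C1_atM; apply: C1_at_comp => //;
  (exact: C1_at_proj1 || exact: C1_at_proj2).
Qed.

Lemma mathieu_kernel_C1_diag x : C1_at W (x, x).
Proof.
have CA := C2_C1 mathieu_sol_C2; have CdA := C2_C1 mathieu_sol_derive_C2.
apply: (@near_eq_C1_at _ (fun u v => (divdiff A u v * dA v - divdiff dA u v * A v) *
    (divdiff (@sin R) (u - v) 0)^-1)).
  have := @cvg_prodB R x x; rewrite subrr => /cvgrPdist_lt /(_ _ (pi_gt0 R)).
  apply: filterS => z.
  by rewrite sub0r normrN => /mathieu_kernel_diag ->.
apply: C1_atM.
  apply: C1_atB; apply: C1_atM.
  - exact: C1_at_divdiff mathieu_sol_C2.
  - exact: C1_at_comp (C1_at_proj2 _).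
  - exact: C1_at_divdiff mathieu_sol_derive_C2.
  - exact: C1_at_comp (C1_at_proj2 _).
apply: C1_atV.
  by rewrite /= subrr divdiffxx (derive1_val (is_derive_sin _)) cos0 oner_eq0.
apply: (C1_at_comp (C1_divdiffl (@C2_sin R) 0)).
by apply: C1_atB; [exact: C1_at_proj1|exact: C1_at_proj2].
Qed.

Hypothesis perA : periodic2pi A.
Hypothesis nzA : exists x, A x != 0.

Lemma mathieu_sol_shift t : sin t = 0 -> exists e, forall x, A (x + t) = e * A x.
Proof.
move=> sin_t; apply: (hill_sol_half_period (mathieu_pot_bound alpha lam)
  (mathieu_sol_hill solA) (mathieu_pot_periodic _ _ sin_t)) => //.
exact: sin_eq0_periodic.
Qed.

Lemma mathieu_kernel_shift t : sin t = 0 -> exists e, forall x y, W (x + t) y = e * W x y.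
Proof.
move=> sin_t; have [e Ae] := mathieu_sol_shift sin_t.
have dAe := is_derive_shift_scale A_dA Ae.
have ddAe := is_derive_shift_scale dA_ddA dAe.
have cos_t := sin_eq0_cos_neq0 sin_t.
exists (e / cos t) => x y; rewrite /mathieu_kernel.
rewrite (_ : x + t - y = (x - y) + t); last by ring.
rewrite [sin (_ + t)]sinD [cos (_ + t)]cosD sin_t !mulr0 addr0 subr0.
rewrite mulf_eq0 (negbTE cos_t) orbF Ae dAe ddAe.
by case: eqP => _; rewrite invfM; ring.
Qed.

Lemma sin_mathieu_kernel x y : sin (x - y) * W x y = A x * dA y - dA x * A y.
Proof.
have [sin0|sin_neq] := eqVneq (sin (x - y)) 0; last by rewrite mathieu_kernelE//; field.
have [e Ae] := mathieu_sol_shift sin0; have := is_derive_shift_scale A_dA Ae y.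
by have := Ae y; rewrite sin0 addrC subrK => -> ->; ring.
Qed.

Lemma mathieu_kernel_periodic x y : W (x + 2 * pi) y = W x y.
Proof.
have per1 u : A (u + 2 * pi) = 1 * A u by rewrite mul1r perA.
have dper1 := is_derive_shift_scale A_dA per1.
have ddper1 := is_derive_shift_scale dA_ddA dper1.
rewrite /mathieu_kernel per1 dper1 ddper1 !mul1r.
by rewrite addrAC [2 * pi]mulr_natl sinD2pi cosD2pi.
Qed.

Lemma mathieu_kernel_C1 : C1_2 W.
Proof.
apply: C1_at_C1_2 => -[x y].
have [sin0|] := eqVneq (sin (x - y)) 0; last exact: mathieu_kernel_C1_regular.
have [e We] := mathieu_kernel_shift sin0.
apply: (@near_eq_C1_at _ (fun u v => e * W (u - (x - y)) v)).
  by apply: (@nearW _ (nbhs (x, y))) => z; rewrite -We subrK.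
apply: C1_atM; first exact: C1_at_cst.
apply: C1_at_shift; rewrite opprB addrC subrK.
exact: mathieu_kernel_C1_diag.
Qed.

Definition mathieu_diag_derive x y : R := - 2 * alpha * sin (x + y) * (A x * A y).

(* Differentiating [sin (x - y) * W x y = A x * A' y - A' x * A y] along the diagonal,
   where [sin (x - y)] is constant. *)
Lemma sin_mathieu_kernel_transport x y :
  sin (x - y) * (partial1of2 W x y + partial2of2 W x y) =
  sin (x - y) * mathieu_diag_derive x y.
Proof.
have [W_d _] := mathieu_kernel_C1.
have Wx : is_derive x 1 (W ^~ y) (partial1of2 W x y) by exact: derivable1P (W_d x y).1.
have Wy : is_derive y 1 (W x) (partial2of2 W x y) by exact: derivable1P (W_d x y).2.
have dx : sin (x - y) * partial1of2 W x y + cos (x - y) * W x y =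
    dA x * dA y - ddA x * A y.
  have lhs : is_derive x 1 (fun u => sin (u - y) * W u y)
      (sin (x - y) * partial1of2 W x y + cos (x - y) * W x y) by derive; ring.
  rewrite -(derive1_val (eq_is_derive (fun u => sin_mathieu_kernel u y) lhs)).
  by apply: derive1_val; derive; ring.
have dy : sin (x - y) * partial2of2 W x y - cos (x - y) * W x y =
    A x * ddA y - dA x * dA y.
  have lhs : is_derive y 1 (fun v => sin (x - v) * W x v)
      (sin (x - y) * partial2of2 W x y - cos (x - y) * W x y) by derive; ring.
  rewrite -(derive1_val (eq_is_derive (fun v => sin_mathieu_kernel x v) lhs)).
  by apply: derive1_val; derive; ring.
transitivity (alpha * (cos (2 * x) - cos (2 * y)) * (A x * A y)).
  by move: dx dy; rewrite mathieu_sol_derive2 /mathieu_pot; lra.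
by rewrite cos_doubleB /mathieu_diag_derive; ring.
Qed.

Lemma mathieu_diag_derive_C1 : C1_2 mathieu_diag_derive.
Proof.
have CA := C2_C1 mathieu_sol_C2; apply: C1_at_C1_2 => p; apply: C1_atM; last first.
  by apply: C1_atM; [exact: C1_at_comp (C1_at_proj1 _)|exact: C1_at_comp (C1_at_proj2 _)].
apply: C1_atM; first exact: C1_at_cst.
by apply: (C1_at_comp (@C1_sin R)); apply: C1_atD; [exact: C1_at_proj1|exact: C1_at_proj2].
Qed.

Lemma mathieu_kernel_transport x y :
  partial1of2 W x y + partial2of2 W x y = mathieu_diag_derive x y.
Proof.
have [_ [_ [cWx cWy]]] := mathieu_kernel_C1; have [_ [cD _]] := mathieu_diag_derive_C1.
apply: (@continuous_eq_dnbhs R (fun t => partial1of2 W t y + partial2of2 W t y)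
  (mathieu_diag_derive ^~ y)).
- apply: cvgD; first exact: (@continuous_slicel _ _ _ (partial1of2 W) y cWx).
  exact: (@continuous_slicel _ _ _ (partial2of2 W) y cWy).
- exact: (@continuous_slicel _ _ _ mathieu_diag_derive y cD).
apply: filterS (near_sin_sub_neq0 x y) => t sin_neq.
exact: (mulfI sin_neq) (sin_mathieu_kernel_transport t y).
Qed.

Lemma mathieu_diag_derive_curl x y :
  partial1of2 mathieu_diag_derive x y - partial2of2 mathieu_diag_derive x y =
  (alpha * cos (2 * y) - alpha * cos (2 * x)) * W x y.
Proof.
have dx : is_derive x 1 (mathieu_diag_derive ^~ y)
    (- 2 * alpha * (cos (x + y) * (A x * A y) + sin (x + y) * (dA x * A y))).
  by rewrite /mathieu_diag_derive; derive; ring.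
have dy : is_derive y 1 (mathieu_diag_derive x)
    (- 2 * alpha * (cos (x + y) * (A x * A y) + sin (x + y) * (A x * dA y))).
  by rewrite /mathieu_diag_derive; derive; ring.
rewrite /partial1of2 /partial2of2 (derive1_val dx) (derive1_val dy).
transitivity (2 * alpha * sin (x + y) * (sin (x - y) * W x y)).
  by rewrite sin_mathieu_kernel; ring.
have -> : alpha * cos (2 * y) - alpha * cos (2 * x) =
    - alpha * (cos (2 * x) - cos (2 * y)) by ring.
by rewrite cos_doubleB; ring.
Qed.

End MathieuKernel.

(** * Integral operators on [0, 2 pi] *)

#[local] Instance ae_lebesgue_filter (R : realType) :
  Filter (nbhs (almost_everywhere (@lebesgue_measure R))) := ae_filter_ringOfSetsType _.

Section IntegralOperators.
Variable R : realType.
Notation mu := (@lebesgue_measure R).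
Notation I := (@I02 R).
Implicit Types (f g h : R -> R) (F G : R -> R -> R) (x y a b : R).

Lemma measurable_I02 : @measurable _ (measurableTypeR R) I.
Proof. exact: (measurable_itv `[0, 2 * pi]). Qed.

Lemma compact_I02 : compact I.
Proof. exact: segment_compact. Qed.

Lemma mu_I02_lty : (mu I < +oo)%E.
Proof. by rewrite /I02 lebesgue_measure_itv /=; case: ifP => _; rewrite ?ltry. Qed.

Let mI := measurable_I02.

Lemma continuous_measurable_I02 f : continuous f ->
  @measurable_fun _ _ (measurableTypeR R) R I f.
Proof.
by move=> cf; apply: (measurable_funS measurableT) => //; exact: continuous_measurable_fun.
Qed.

Lemma continuous_bounded_I02 f : continuous f -> [bounded f x | x in I].
Proof.
move=> cf; have [M [Mr MM]] : bounded_set (f @` I).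
  apply: compact_bounded; apply: continuous_compact compact_I02.
  exact: continuous_subspaceT.
by exists M; split => // N MN x Ix; apply: MM => //; exists x.
Qed.

Lemma continuous_integrable_I02 f : continuous f -> mu.-integrable I (EFin \o f).
Proof. exact: continuous_itv_integrable. Qed.

Lemma integrable_continuousM f g : continuous g -> mu.-integrable I (EFin \o f) ->
  mu.-integrable I (EFin \o (fun y => g y * f y)).
Proof.
move=> cg fi.
have := integrableMr mI (continuous_measurable_I02 cg) (continuous_bounded_I02 cg) fi.
by apply: eq_integrable => // y _ /=; rewrite EFinM.
Qed.

Lemma continuous_sq_int f : continuous f -> sq_int f.
Proof.
move=> cf; split; first exact: continuous_measurable_I02.
by apply: (@continuous_integrable_I02 (fun x => f x ^+ 2)) => x; apply: cvgM; exact: cf.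
Qed.

Lemma sq_int_integrable f : sq_int f -> mu.-integrable I (EFin \o f).
Proof.
move=> [mf f2i].
have cst1i : mu.-integrable I (EFin \o cst 1).
  by apply: continuous_integrable_I02 => x; exact: cvg_cst.
apply: le_integrable (integrableD mI cst1i f2i) => //; first exact/measurable_EFinP.
move=> x _ /=; rewrite lee_fin [leRHS]ger0_norm ?addr_ge0 ?sqr_ge0//.
rewrite -real_normK ?num_real//; have := sqr_ge0 (`|f x| - 1).
by have := normr_ge0 (f x); lra.
Qed.

Lemma continuous_bounded_strip F a b : continuous (fun z : R * R => F z.1 z.2) ->
  exists2 M : R, 0 <= M & forall x y, a <= x <= b -> I y -> `|F x y| <= M.
Proof.
move=> cF; have [M [Mr MM]] :
    bounded_set ((fun z : R * R => F z.1 z.2) @` (`[a, b]%classic `*` I)).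
  apply: compact_bounded; apply: continuous_compact; first exact: continuous_subspaceT.
  by apply: compact_setX; [exact: segment_compact|exact: compact_I02].
exists (`|M| + 1) => // x y xab Iy; apply: MM.
  by rewrite (le_lt_trans (ler_norm M))// ltrDl.
by exists (x, y) => //; split => //=; rewrite in_itv.
Qed.

Lemma continuous_intop F f : continuous (fun z : R * R => F z.1 z.2) ->
  mu.-integrable I (EFin \o f) -> continuous (intop F f).
Proof.
move=> cF fi a; have [M M0 FM] := continuous_bounded_strip (a - 1) (a + 1) cF.
have a_near : a \in (`]a - 1, a + 1[%classic : set R).
  by apply/mem_set; rewrite /= in_itv /=; apply/andP; split; lra.
apply: (@continuity_under_integral R _ _ mu (fun x y => F x y * f y) I mI (a - 1) (a + 1)
  _ _ (fun y => M * `|f y|) _ _ a a_near).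
- by move=> x _; apply: integrable_continuousM => //; exact: continuous_slicer.
- apply: aeW => y _ x _; apply: cvgM; last exact: cvg_cst.
  exact: (@continuous_slicel _ _ _ F y cF).
- by apply: eq_integrable (integrableZl mI M (integrable_norm fi)).
- move=> x; rewrite /= in_itv /= => /andP[xa xb]; apply: aeW => y Iy.
  by rewrite normrM ler_wpM2r// FM// !ltW.
Qed.

Lemma is_derive_intop F f x : C1_2 F -> mu.-integrable I (EFin \o f) ->
  is_derive x 1 (intop F f) (intop (partial1of2 F) f x).
Proof.
move=> [F_d [cF [cFx _]]] fi.
have [M M0 FM] := @continuous_bounded_strip (partial1of2 F) (x - 1) (x + 1) cFx.
pose near_x : set R := `]x - 1, x + 1[%classic.
have x_near : near_x x by rewrite /near_x /= in_itv /=; apply/andP; split; lra.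
have kernel_d (t y : R) : is_derive t 1 (fun t => F t y * f y) (partial1of2 F t y * f y).
  have F_dx : is_derive t 1 (F ^~ y) (partial1of2 F t y) by exact: derivable1P (F_d t y).1.
  by derive; ring.
have kernel_i t : near_x t -> mu.-integrable I (EFin \o (fun y => F t y * f y)).
  by move=> _; apply: integrable_continuousM => //; exact: continuous_slicer.
have kernel_derivable t y : near_x t -> I y -> derivable (fun t => F t y * f y) t 1.
  by move=> _ _; have ? := kernel_d t y; exact: ex_derive.
have dominant_ge0 y : 0 <= M * `|f y| by rewrite mulr_ge0.
have dominant_i : mu.-integrable I (EFin \o (fun y => M * `|f y|)).
  by apply: eq_integrable (integrableZl mI M (integrable_norm fi)).
have dominated t y : near_x t -> I y ->
    `|partial1of2 (fun x y => F x y * f y) t y| <= M * `|f y|.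
  rewrite /near_x /= in_itv /= => /andP[xt tx] Iy.
  rewrite /partial1of2 (derive1_val (kernel_d t y)) normrM ler_wpM2r//.
  by rewrite FM// !ltW.
apply: (is_derive_eq (derivable1P (derivable_under_integral mI x_near kernel_i
  kernel_derivable dominant_ge0 dominant_i dominated))).
rewrite (differentiation_under_integral mI x_near kernel_i
  kernel_derivable dominant_ge0 dominant_i dominated).
by apply: eq_Rintegral => y _; exact: derive1_val (kernel_d x y).
Qed.

Lemma C1_intop F f : C1_2 F -> mu.-integrable I (EFin \o f) -> C1 (intop F f).
Proof.
move=> C1F fi; apply: (@is_derive_C1 _ _ (intop (partial1of2 F) f)).
  by move=> x; exact: is_derive_intop.
exact: continuous_intop C1F.2.2.1 fi.
Qed.

Lemma eq_intop_ae F f g x : continuous (F x) -> measurable_fun I f -> measurable_fun I g ->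
  {ae mu, forall y, I y -> f y = g y} -> intop F f x = intop F g x.
Proof.
move=> cF mf mg fg; congr fine; apply: ae_eq_integral => //.
- by apply/measurable_EFinP; apply: measurable_funM => //; exact: continuous_measurable_I02.
- by apply/measurable_EFinP; apply: measurable_funM => //; exact: continuous_measurable_I02.
- by apply: filterS fg => y fgy Iy; rewrite fgy.
Qed.

Lemma intopD F f g x : continuous (F x) -> mu.-integrable I (EFin \o f) ->
  mu.-integrable I (EFin \o g) ->
  intop F (fun y => f y + g y) x = intop F f x + intop F g x.
Proof.
move=> cF fi gi; rewrite -RintegralD//; last 2 first.
- exact: integrable_continuousM.
- exact: integrable_continuousM.
by apply: eq_Rintegral => y _; rewrite mulrDr.
Qed.

Lemma intopZ F f (c : R) x : continuous (F x) -> mu.-integrable I (EFin \o f) ->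
  intop F (fun y => c * f y) x = c * intop F f x.
Proof.
move=> cF fi; rewrite -RintegralZl//; last exact: integrable_continuousM.
by apply: eq_Rintegral => y _; rewrite mulrCA.
Qed.

Lemma intop_kernelB F G f x : continuous (F x) -> continuous (G x) ->
  mu.-integrable I (EFin \o f) ->
  intop (fun x y => F x y - G x y) f x = intop F f x - intop G f x.
Proof.
move=> cF cG fi; rewrite -RintegralB//; last 2 first.
- exact: integrable_continuousM.
- exact: integrable_continuousM.
by apply: eq_Rintegral => y _; rewrite mulrBl.
Qed.

Lemma intop_by_parts F h x : C1 (F x) -> C1 h ->
  F x (2 * pi) = F x 0 -> h (2 * pi) = h 0 ->
  intop (partial2of2 F) h x = - intop F (derive1 h) x.
Proof.
move=> C1F C1h F_ends h_ends.
have pi0 : 0 < 2 * pi :> R by rewrite mulr_gt0 ?pi_gt0.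
have C1_LRcontinuous (u : R -> R) : C1 u -> derivable_oo_LRcontinuous u 0 (2 * pi).
  move=> C1u; split; first by move=> y _; exact: C1u.1.
  - by apply: cvg_at_right_filter; exact: C1_continuous C1u _.
  - by apply: cvg_at_left_filter; exact: C1_continuous C1u _.
have := @Rintegration_by_parts R h (F x) (derive1 h) (derive1 (F x)) 0 (2 * pi) pi0.
rewrite F_ends h_ends subrr sub0r => by_parts.
rewrite /intop; under eq_Rintegral do rewrite mulrC.
rewrite by_parts //.
- by congr (- _); apply: eq_Rintegral => y _; rewrite mulrC.
- exact: continuous_subspaceT C1h.2.
- exact: C1_LRcontinuous.
- exact: continuous_subspaceT C1F.2.
- exact: C1_LRcontinuous.
Qed.

End IntegralOperators.

Section CommutingKernel.
Variable R : realType.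
Notation mu := (@lebesgue_measure R).
Notation I := (@I02 R).
Implicit Types (f g h : R -> R) (x y : R).

Variables (W D : R -> R -> R) (q : R -> R).
Hypothesis C1W : C1_2 W.
Hypothesis W_periodicl : forall x y, W (x + 2 * pi) y = W x y.
Hypothesis W_periodicr : forall x y, W x (y + 2 * pi) = W x y.
Hypothesis C1D : C1_2 D.
Hypothesis D_periodicr : forall x y, D x (y + 2 * pi) = D x y.
Hypothesis transport : forall x y, partial1of2 W x y + partial2of2 W x y = D x y.
Hypothesis cq : continuous q.
Hypothesis curl : forall x y,
  partial1of2 D x y - partial2of2 D x y = (q y - q x) * W x y.

Let periodic_ends (f : R -> R) : periodic f (2 * pi) -> f (2 * pi) = f 0.
Proof. by move=> fp; rewrite -[2 * pi]add0r fp. Qed.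

Let C1_integrable f : C1 f -> mu.-integrable I (EFin \o f).
Proof. by move=> C1f; apply: continuous_integrable_I02; exact: C1_continuous. Qed.

Lemma intop_transport h x : C1 h -> periodic2pi h ->
  intop (partial1of2 W) h x = intop D h x + intop W (derive1 h) x.
Proof.
move=> C1h hp; have hi := C1_integrable C1h.
transitivity (intop (fun x y => D x y - partial2of2 W x y) h x).
  by apply: eq_Rintegral => y _; rewrite -transport addrK.
rewrite intop_kernelB//; last 2 first.
- exact: C1_continuous (C1_2_slicer x C1D).
- exact: (C1_2_slicer x C1W).2.
rewrite intop_by_parts ?opprK//; [exact: C1_2_slicer|exact: periodic_ends..].
Qed.

Lemma is_derive2_intop h x : C1 h -> periodic2pi h ->
  is_derive x 1 (derive1 (intop W h))
    (intop (partial1of2 D) h x + intop (partial1of2 W) (derive1 h) x).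
Proof.
move=> C1h hp; have hi := C1_integrable C1h.
have dhi := continuous_integrable_I02 C1h.2.
apply: (@eq_is_derive _ (fun t => intop D h t + intop W (derive1 h) t)) => [t|].
  by rewrite (derive1_val (is_derive_intop t C1W hi)) intop_transport.
by apply: is_derive_add; exact: is_derive_intop.
Qed.

Lemma C2_intop h : C1 h -> periodic2pi h -> C2 (intop W h).
Proof.
move=> C1h hp; have hi := C1_integrable C1h.
have dhi := continuous_integrable_I02 C1h.2.
apply: (@is_derive_C2 _ _ (derive1 (intop W h))) (fun x => is_derive2_intop x C1h hp) _.
  by move=> x; apply: derivable1P; exact: (C1_intop C1W hi).1.
by move=> x; apply: cvgD; [exact: continuous_intop C1D.2.2.1 hi _|
  exact: continuous_intop C1W.2.2.1 dhi _].
Qed.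

Lemma periodic_intop f : periodic2pi (intop W f).
Proof. by move=> x; apply: eq_Rintegral => y _; rewrite W_periodicl. Qed.

Lemma intop_commutes h x : C2 h -> periodic2pi h ->
  derive1 (derive1 (intop W h)) x + q x * intop W h x =
  intop W (fun y => derive1 (derive1 h) y + q y * h y) x.
Proof.
move=> C2h hp; have C1h := C2_C1 C2h; have hi := C1_integrable C1h.
have C1dh : C1 (derive1 h) by exact: C2h.2.
have dhp := periodic_derive (fun t => derivable1P (C1h.1 t)) hp.
have cW := C1_continuous (C1_2_slicer x C1W).
have cqh : continuous (fun y => q y * h y).
  by move=> y; apply: cvgM; [exact: cq|exact: C1_continuous C1h _].
have D_curl : intop (partial1of2 D) h x - intop (partial2of2 D) h x =
    intop W (fun y => q y * h y) x - q x * intop W h x.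
  rewrite -intop_kernelB//; [|exact: C1_2_partial1_continuous|exact: (C1_2_slicer x C1D).2].
  rewrite -mulNr -intopZ// -intopD//.
  - by apply: eq_Rintegral => y _; rewrite curl; ring.
  - exact: continuous_integrable_I02.
  - exact: (C1_integrable (C1_scale _ C1h)).
have D_by_parts : intop (partial2of2 D) h x = - intop D (derive1 h) x.
  by apply: intop_by_parts; [exact: C1_2_slicer|exact: C1h|exact: periodic_ends..].
rewrite (derive1_val (is_derive2_intop x C1h hp)) (intop_transport x C1dh dhp).
rewrite intopD//; last 2 first.
- exact: continuous_integrable_I02 C1dh.2.
- exact: continuous_integrable_I02.
rewrite D_by_parts opprK in D_curl.
by rewrite addrA D_curl addrAC subrK addrC.
Qed.

Lemma eigenfun_C2_representative (nu : R) f : nu != 0 -> eigenfun W nu f ->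
  exists g, [/\ {ae mu, forall x, I x -> g x = f x}, periodic2pi g, C2 g &
    forall x, intop W g x = nu * g x].
Proof.
move=> nu0 [sf [_ f_eigen]]; have fi := sq_int_integrable sf.
have cW x : continuous (W x) by exact: C1_continuous (C1_2_slicer x C1W).
pose g x := nu^-1 * intop W f x.
have gf : {ae mu, forall x, I x -> g x = f x}.
  by apply: filterS f_eigen => x fx Ix; rewrite /g fx// mulKf.
have C1g : C1 g by apply: C1_scale; exact: C1_intop.
have Wg x : intop W g x = nu * g x.
  rewrite [RHS]mulVKf//; apply: eq_intop_ae => //; last exact: sf.1.
  exact: (continuous_sq_int (C1_continuous C1g)).1.
have gE : g = intop W (fun y => nu^-1 * g y).
  by apply/funext => x; rewrite intopZ ?Wg ?mulKf//; exact: C1_integrable.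
have gp : periodic2pi g by rewrite gE; exact: periodic_intop.
exists g; split => //; rewrite gE; apply: C2_intop; first exact: C1_scale.
by move=> x; rewrite gp.
Qed.

Lemma simple_eigenfun_commuting (nu : R) f : nu != 0 -> simple_eigenvalue W nu ->
  eigenfun W nu f -> exists g c, [/\ {ae mu, forall x, I x -> g x = f x},
    periodic2pi g, C2 g & forall x, derive1 (derive1 g) x + q x * g x = c * g x].
Proof.
move=> nu0 [_ simple] f_eigen.
have [g [gf gp C2g Wg]] := eigenfun_C2_representative nu0 f_eigen.
have cW x : continuous (W x) by exact: C1_continuous (C1_2_slicer x C1W).
have C1g := C2_C1 C2g; have cg := C1_continuous C1g.
pose Lg x := derive1 (derive1 g) x + q x * g x.
have cLg : continuous Lg.
  by move=> x; apply: cvgD; [exact: C2g.2.2|apply: cvgM; [exact: cq|exact: cg]].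
have WLg x : intop W Lg x = nu * Lg x.
  rewrite -intop_commutes// (_ : intop W g = fun t => nu * g t); last exact/funext.
  have -> : derive1 (fun t => nu * g t) = fun t => nu * derive1 g t.
    by apply/funext => t; apply: derive1Ml; exact: C1g.1.
  by rewrite derive1Ml; [rewrite /Lg; ring|exact: C2g.2.1].
have g_eigen : eigenfun W nu g.
  split; first exact: continuous_sq_int.
  split; last by apply: aeW => x _; exact: Wg.
  move=> g0; apply: f_eigen.2.1; apply: filterS2 g0 gf => x gx0 gx Ix.
  by rewrite -gx// gx0.
have [c Lg_ae] : exists c, {ae mu, forall x, I x -> Lg x = c * g x}.
  have [Lg0|Lg_neq0] := pselect {ae mu, forall x, I x -> Lg x = 0}.
    by exists 0; apply: filterS Lg0 => x Lgx0 Ix; rewrite Lgx0// mul0r.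
  apply: (simple g Lg g_eigen); split; first exact: continuous_sq_int.
  by split => //; apply: aeW => x _; exact: WLg.
exists g, c; split => // x; apply: (mulfI nu0).
rewrite -/(Lg x) -WLg mulrCA -Wg -intopZ//; last exact: C1_integrable.
apply: eq_intop_ae => //; first exact: (continuous_sq_int cLg).1.
exact: (continuous_sq_int (C1_continuous (C1_scale c C1g))).1.
Qed.

End CommutingKernel.

Section IntegrableProduct.
Context d1 d2 (T1 : measurableType d1) (T2 : measurableType d2) (R : realType).
Variables (m1 : {sigma_finite_measure set T1 -> \bar R})
  (m2 : {sigma_finite_measure set T2 -> \bar R}).

Lemma integrable_prod_mul (f : T1 -> R) (g : T2 -> R) :
  m1.-integrable setT (EFin \o f) -> m2.-integrable setT (EFin \o g) ->
  (m1 \x m2)%E.-integrable setT (fun z => (f z.1 * g z.2)%:E).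
Proof.
move=> fi gi.
have mf : measurable_fun setT f by exact/measurable_EFinP/(measurable_int m1).
have mg : measurable_fun setT g by exact/measurable_EFinP/(measurable_int m2).
apply/integrable12ltyP.
  by apply/measurable_EFinP; apply: measurable_funM; exact: measurableT_comp.
have norm_g_fin : (\int[m2]_y `|g y|%:E)%E \is a fin_num.
  by apply: integrable_fin_num => //; exact: (integrable_norm gi).
have -> : (\int[m1]_x \int[m2]_y `|(f (x, y).1 * g (x, y).2)%:E|)%E =
    (\int[m1]_x ((fine (\int[m2]_y `|g y|%:E))%:E * `|f x|%:E))%E.
  apply: eq_integral => x _; rewrite fineK// muleC -ge0_integralZl_EFin//.
    by apply: eq_integral => y _; rewrite /= normrM EFinM.
  by apply/measurable_EFinP; exact: measurableT_comp.
by apply: integrable_lty => //; apply: integrableZl => //; exact: (integrable_norm fi).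
Qed.

End IntegrableProduct.

Section SymmetricKernel.
Variable R : realType.
Notation mu := (@lebesgue_measure R).
Notation I := (@I02 R).
Notation TR := (measurableTypeR R).
Implicit Types (f g : R -> R) (x y : R).

Variable W : R -> R -> R.
Hypothesis cW : continuous (fun z : R * R => W z.1 z.2).

Let measurable_W : @measurable_fun _ _ (TR * TR)%type R setT (fun z : R * R => W z.1 z.2).
Proof. exact: continuous_measurable_prod. Qed.

Lemma continuous_hilbert_schmidt : hilbert_schmidt_kernel W.
Proof.
have mII : @measurable _ (TR * TR)%type (I `*` I).
  by apply: measurableX; exact: measurable_I02.
have mWI : @measurable_fun _ _ (TR * TR)%type R (I `*` I) (fun z : R * R => W z.1 z.2).
  exact: measurable_funS measurable_W.
split; first exact: mWI.
split; last first.
  move=> f sf; apply: continuous_sq_int; apply: continuous_intop => //.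
  exact: sq_int_integrable.
have [M M0 WM] := continuous_bounded_strip 0 (2 * pi) cW.
apply: (@measurable_bounded_integrable _ (TR * TR)%type R (mu \x mu)%E
  (fun z : R * R => W z.1 z.2 ^+ 2) (I `*` I) mII).
- rewrite /= product_measure1E//; try exact: measurable_I02.
  by rewrite lte_mul_pinfty// ?mu_I02_lty// ge0_fin_numE// mu_I02_lty.
- exact: measurable_funX.
- exists (M ^+ 2); split; first exact: num_real.
  move=> N MN -[x y] [Ix Iy] /=; apply: le_trans (ltW MN).
  by rewrite normrX lerXn2r ?nnegrE// WM.
Qed.

Definition kernel_pairing (F : R -> R -> R) f g (z : R * R) : R :=
  F z.1 z.2 * (f \_ I) z.2 * (g \_ I) z.1.

Lemma kernel_pairing_integrable f g :
  mu.-integrable I (EFin \o f) -> mu.-integrable I (EFin \o g) ->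
  (mu \x mu)%E.-integrable [set: TR * TR] (EFin \o kernel_pairing W f g).
Proof.
have mI := @measurable_I02 R.
have restrict_i h : mu.-integrable I (EFin \o h) -> mu.-integrable setT (EFin \o (h \_ I)).
  by move=> hi; have := (integrable_mkcond _ mI).1 hi; rewrite restrict_EFin.
move=> /restrict_i fi /restrict_i gi.
have mf : @measurable_fun _ _ TR R setT (f \_ I).
  by apply/measurable_EFinP; exact: (measurable_int mu fi).
have mg : @measurable_fun _ _ TR R setT (g \_ I).
  by apply/measurable_EFinP; exact: (measurable_int mu gi).
have [M M0 WM] := continuous_bounded_strip 0 (2 * pi) cW.
have dominated x y :
    `|kernel_pairing W f g (x, y)| <= `|M * ((g \_ I) x * (f \_ I) y)|.
  rewrite /kernel_pairing /= !normrM mulrAC -mulrA (ger0_norm M0).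
  have [Ix|Ix] := pselect (I x); last first.
    by rewrite [(g \_ I) x]patchE memNset// normr0 !mul0r !mulr0.
  have [Iy|Iy] := pselect (I y); last first.
    by rewrite [(f \_ I) y]patchE memNset// normr0 !mulr0.
  by rewrite ler_wpM2r ?mulr_ge0// WM.
apply: le_integrable (integrableZl measurableT M (integrable_prod_mul gi fi)) => //.
  apply/measurable_EFinP; apply: measurable_funM; first apply: measurable_funM => //.
  + exact: (measurableT_comp mf measurable_snd).
  + exact: (measurableT_comp mg measurable_fst).
by move=> [x y] _; rewrite /= lee_fin dominated.
Qed.

Lemma integral_intop_pairing f g :
  mu.-integrable I (EFin \o f) -> mu.-integrable I (EFin \o g) ->
  (\int[mu]_(x in I) (intop W f x * g x)%:E =
   \int[mu]_x \int[mu]_y (kernel_pairing W f g (x, y))%:E)%E.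
Proof.
move=> fi gi; have mI := @measurable_I02 R.
have Wfi x := integrable_continuousM (@continuous_slicer _ _ _ W x cW) fi.
rewrite [LHS]integral_mkcond; apply: eq_integral => x _.
rewrite patchE /kernel_pairing /=; case: ifPn => xI; last first.
  under eq_integral do rewrite [(g \_ I) x]patchE (negbTE xI) mulr0.
  by rewrite integral0.
transitivity (\int[mu]_(y in I) ((W x y * f y)%:E * (g x)%:E))%E.
  rewrite integralZr//; last exact: Wfi.
  by rewrite EFinM /intop /Rintegral fineK//; exact: integrable_fin_num (Wfi x).
rewrite integral_mkcond; apply: eq_integral => y _.
rewrite !patchE xI; case: ifP => _; first by rewrite -EFinM.
by rewrite mulr0 mul0r.
Qed.

Hypothesis symW : forall x y, W x y = W y x.

Lemma symmetric_self_adjoint : self_adjoint_kernel W.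
Proof.
move=> f g /sq_int_integrable fi /sq_int_integrable gi.
under [RHS]eq_integral do rewrite mulrC.
transitivity (\int[mu]_x \int[mu]_y (kernel_pairing W f g (x, y))%:E)%E.
  exact: integral_intop_pairing.
transitivity (\int[mu]_y \int[mu]_x (kernel_pairing W f g (x, y))%:E)%E.
  exact: Fubini (kernel_pairing_integrable fi gi).
rewrite (integral_intop_pairing gi fi); apply: eq_integral => y _; apply: eq_integral => x _.
by rewrite /= /kernel_pairing /= symW mulrAC.
Qed.

End SymmetricKernel.

Section MathieuKernelOperator.
Variable R : realType.
Variables (alpha lam : R) (A : R -> R).
Hypothesis solA : mathieu_sol alpha lam A.
Hypothesis perA : periodic2pi A.
Hypothesis nzA : exists x, A x != 0.

Notation W := (mathieu_kernel A).

Lemma mathieu_kernel_periodicr x y : W x (y + 2 * pi) = W x y.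
Proof.
rewrite [LHS](mathieu_kernelC solA) (mathieu_kernel_periodic solA)//.
exact: (mathieu_kernelC solA).
Qed.

Lemma mathieu_kernel_simple_eigenfun (nu : R) f : nu != 0 -> simple_eigenvalue W nu ->
  eigenfun W nu f -> exists g c, [/\ {ae lebesgue_measure, forall x, I02 x -> g x = f x},
    periodic2pi g, C2 g &
    forall x, derive1 (derive1 g) x + alpha * cos (2 * x) * g x = c * g x].
Proof.
apply: (@simple_eigenfun_commuting R W (mathieu_diag_derive alpha A)
  (fun x => alpha * cos (2 * x))).
- exact: mathieu_kernel_C1 solA perA nzA.
- exact: mathieu_kernel_periodic solA perA.
- exact: mathieu_kernel_periodicr.
- exact: mathieu_diag_derive_C1 solA.
- by move=> x y; rewrite /mathieu_diag_derive perA addrA [2 * pi]mulr_natl sinD2pi.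
- exact: mathieu_kernel_transport solA perA nzA.
- by move=> x; have := @continuous_mathieu_pot R alpha 0 x; rewrite /mathieu_pot;
    under eq_fun do rewrite add0r.
- exact: mathieu_diag_derive_curl solA perA nzA.
Qed.

End MathieuKernelOperator.

Unset Implicit Arguments.

Theorem theorem6p1 (R : realType) (alpha : R) :
  infinite_set [set lam : R | exists y : R -> R,
      mathieu_sol alpha lam y /\ periodic2pi y /\ exists x, y x != 0] /\
  (forall (lam : R) (A : R -> R),
     mathieu_sol alpha lam A -> periodic2pi A -> (exists x, A x != 0) ->
     exists W : R -> R -> R,
       C1_2 W /\
       (forall x y, W (x + 2 * pi) y = W x y /\ W x (y + 2 * pi) = W x y) /\
       (forall x y, sin (x - y) != 0 ->
          W x y = (A x * derive1 A y - derive1 A x * A y) / sin (x - y)) /\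
       (* (i) *)
       (hilbert_schmidt_kernel W /\ self_adjoint_kernel W) /\
       (* (ii) *)
       (forall nu : R, nu != 0 -> simple_eigenvalue W nu ->
          forall f : R -> R, eigenfun W nu f ->
            exists g : R -> R,
              {ae lebesgue_measure, forall x, I02 x -> g x = f x} /\
              periodic2pi g /\ C2 g /\
              exists mu : R, forall x,
                derive1 (derive1 g) x + (mu + alpha * cos (2 * x)) * g x = 0)).
Proof.
split; first exact: mathieu_periodic_infinite.
move=> lam A solA perA nzA; exists (mathieu_kernel A).
have C1W := mathieu_kernel_C1 solA perA nzA; have cW := C1W.2.1.
split; first exact: C1W.
split.
  move=> x y; split; first exact: mathieu_kernel_periodic solA perA x y.
  exact: mathieu_kernel_periodicr solA perA x y.
split; first exact: mathieu_kernelE.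
split.
  split; first exact: continuous_hilbert_schmidt.
  exact: symmetric_self_adjoint cW (mathieu_kernelC solA).
move=> nu nu0 simple f f_eigen.
have [g [c [gf gp C2g gE]]] :=
  mathieu_kernel_simple_eigenfun solA perA nzA nu0 simple f_eigen.
exists g; split; first exact: gf.
split; first exact: gp.
split; first exact: C2g.
by exists (- c) => x; have := gE x; lra.
Qed.
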